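(* 1) No infinite circulant graph with $2$ distances has a perfect $2$-colouring with parameters $(4,3)$. 2) No infinite circulant graph with $3$ distances has a perfect $2$-colouring with parameters $(5,3)$, $(5,4)$, $(6,4)$ or $(6,5)$. 3) No infinite circulant graph with $4$ distances has a perfect $2$-colouring with parameters $(6,5)$, $(7,4)$, $(8,3)$, $(7,5)$, $(7,6)$, $(8,5)$, $(8,6)$ or $(8,7)$.
   Context: Graphs may have loops and multiple edges. An infinite circulant graph with $k$ distances is a graph $C_\infty(l_1,\dots,l_k)$, where $l_1,\dots,l_k$ are nonnegative integers (not required to be distinct or nonzero), with vertex set $\mathbb{Z}$, in which numbers differing by $l_i$, for some $i$, are joined by an edge; it is $2k$-regular, the neighbours of a vertex $g$, counted with multiplicity, being $g+l_i$ and $g-l_i$ for $i=1,\dots,k$. A perfect $2$-colouring with parameters $(b,c)$ of a regular graph is a colouring of its vertices in two colours (black and white) such that each black vertex has exactly $b$ white neighbours and each white vertex has exactly $c$ black neighbours (neighbours counted with multiplicity). *)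

(* Defs.v *)
From mathcomp Require Import all_boot all_order all_algebra.

Set Implicit Arguments.
Unset Strict Implicit.
Unset Printing Implicit Defensive.

Import GRing.Theory.
Local Open Scope ring_scope.

(* A locally finite graph, with loops and multiple edges allowed, is given by
   its neighbour lists: an edge between v and w of multiplicity m puts m copies
   of w in the list of v. *)
Definition neighbourhood (V : Type) := V -> seq V.

(* The graph C_oo(l_1, ..., l_k). Each l_i contributes both g + l_i and g - l_i,
   so l_i = 0 contributes g itself twice. *)
Definition circulant (k : nat) (l : k.-tuple nat) : neighbourhood int :=
  fun g => [seq g + d%:Z | d <- l] ++ [seq g - d%:Z | d <- l].

Lemma size_circulant (k : nat) (l : k.-tuple nat) (g : int) :
  size (circulant l g) = (2 * k)%N.
Proof. by rewrite size_cat !size_map size_tuple mul2n addnn. Qed.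

Lemma circulant_sym (k : nat) (l : k.-tuple nat) (g h : int) :
  count_mem h (circulant l g) = count_mem g (circulant l h).
Proof.
rewrite !count_cat !count_map addnC; congr (_ + _)%N; apply: eq_count => d /=.
  by rewrite subr_eq eq_sym.
by rewrite subr_eq eq_sym.
Qed.

Inductive colour := Black | White.

Definition is_black (x : colour) : bool := if x is Black then true else false.
Definition is_white (x : colour) : bool := if x is White then true else false.

(* [count] runs over the neighbour list, hence counts with multiplicity. For
   b, c > 0 and V nonempty, both colours are necessarily used. *)
Definition perfect_2colouring (V : Type) (nbrs : neighbourhood V) (b c : nat)
    (f : V -> colour) : Prop :=
  forall v : V,
    match f v with
    | Black => count (fun w => is_white (f w)) (nbrs v) = b
    | White => count (fun w => is_black (f w)) (nbrs v) = c
    end.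

Definition has_perfect_2colouring (V : Type) (nbrs : neighbourhood V)
    (b c : nat) : Prop :=
  exists f : V -> colour, perfect_2colouring nbrs b c f.

(* Main.v *)
Require Import Defs.
From mathcomp Require Import all_boot all_order all_algebra.
From mathcomp Require Import all_field.
From mathcomp Require Import zify ring lra.

(* The black indicator [f] satisfies [A f = c + lam f], where [A] is the
   adjacency operator and [lam = 2 k - (b + c)]. We may assume that the distances
   are setwise coprime, and [f] has some period [N]. Every [N]-th root of unity
   [z <> 1] at which the Fourier transform of [f] does not vanish satisfies
   [eigsum l z = lam], i.e. the sum of the [z ^ d + z ^ -d] over the distances
   [d] equals [lam]. On the other hand the density [c / (b + c)] of black has [p]
   in its denominator, which forces roots [z] of order divisible by [p] to occur,
   and roots with [e] distinct positive [p]-adic valuations of the order if [p ^ e]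
   divides the denominator (this uses that [f] takes integer values).

   The normalized trace of a root of unity of order [n] is [mu n / phi n], which is
   [-1] for [n = 2], [- 1/2] for [n = 3] and at least [- 1/4] otherwise. As [lam]
   is close to [- 2 k], the trace of the equation [eigsum l z = lam] leaves so few
   possibilities for the [z ^ d] that the required orders are excluded. For [p = 2]
   one also compares the equation with its conjugate under the automorphism that
   negates the [z ^ d] with [d] odd.

   If [p = b + c] is prime and [p > 2 k], then [A ^ p = A_p] modulo [p], where [A_p]
   belongs to the distances [p d], gives [f (g + p d) = f g], so one may take
   [N = p]. *)

Set Implicit Arguments.
Unset Strict Implicit.
Unset Printing Implicit Defensive.
Import Order.TTheory GRing.Theory Num.Theory.
Local Open Scope ring_scope.

(** * Traces of roots of unity *)

Lemma eqn_mod_mull (u m n d : nat) :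
  coprime u d -> (u * m == u * n %[mod d])%N = (m == n %[mod d])%N.
Proof.
move=> cud; wlog le_mn : m n / (m <= n)%N => [hw|].
  case: (leqP m n) => [|/ltnW] /hw // e.
  by rewrite eq_sym e eq_sym.
rewrite eq_sym [RHS]eq_sym !eqn_mod_dvd ?leq_mul // -mulnBr Gauss_dvdr //.
by rewrite coprime_sym.
Qed.

(** For [z ^+ N = 1] this is the trace of [z] from the [N]-th cyclotomic field to the rationals, as
    an explicit sum over the units modulo [N]. *)
Definition unit_trace (N : nat) (z : algC) : algC :=
  \sum_(t < N | coprime t N) z ^+ t.

(** Multiplication by [u] permutes the units modulo [N]. *)
Lemma unit_trace_exp (N u : nat) (z : algC) :
  (0 < N)%N -> z ^+ N = 1 -> coprime u N ->
  unit_trace N (z ^+ u) = unit_trace N z.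
Proof.
move=> N_gt0 zN cuN; rewrite /unit_trace.
pose h (t : 'I_N) := Ordinal (ltn_pmod (u * t) N_gt0).
have h_inj : injective h.
  move=> t1 t2 /(congr1 val) /= /eqP; rewrite eqn_mod_mull //.
  by rewrite !modn_small // => /eqP /val_inj.
rewrite [RHS](reindex_inj h_inj) /=; apply: eq_big => t.
  by rewrite coprime_modl coprimeMl cuN.
by move=> _; rewrite expr_mod // exprM.
Qed.

Lemma unit_traceV (N : nat) (z : algC) :
  (0 < N)%N -> z ^+ N = 1 -> unit_trace N z^-1 = unit_trace N z.
Proof.
move=> N_gt0 zN; have -> : z^-1 = z ^+ N.-1.
  have nz : z != 0.
    apply: contra_eq_neq zN => ->.
    by rewrite expr0n eqn0Ngt N_gt0 eq_sym oner_eq0.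
  by apply: (mulfI nz); rewrite divff // -exprS prednK.
apply: unit_trace_exp => //.
by case: N N_gt0 {zN} => // n _; rewrite coprimenS.
Qed.

Lemma unit_trace1_neq0 (N : nat) : (0 < N)%N -> unit_trace N 1 != 0.
Proof.
move=> N_gt0; rewrite /unit_trace; under eq_bigr do rewrite expr1n.
rewrite sumr_const pnatr_eq0 -lt0n; apply/card_gt0P.
exists (Ordinal (ltn_pmod 1 N_gt0)).
by rewrite -[_ \in _]/(coprime (1 %% N) N) coprime_modl coprime1n.
Qed.

Lemma sum_expr_step (R : idomainType) (p h : nat) (z : R) :
  z ^+ (h * p) = 1 -> z ^+ h != 1 -> \sum_(j < p) z ^+ (1 + j * h) = 0.
Proof.
move=> zhp zh; have := subrX1 (z ^+ h) p; rewrite -exprM zhp subrr.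
move/esym/eqP; rewrite mulf_eq0 subr_eq0 (negPf zh) /= => /eqP s0.
rewrite (eq_bigr (fun j : 'I_p => z * (z ^+ h) ^+ j)).
  by rewrite -big_distrr /= s0 mulr0.
by move=> j _; rewrite exprD expr1 mulnC exprM.
Qed.

Lemma exp_mod_gcd (R : nzRingType) (m n : nat) (z : R) :
  z ^+ m = 1 -> z ^+ n = 1 -> z ^+ gcdn m n = 1.
Proof.
move=> zm zn; have [->|m0] := posnP m; first by rewrite gcd0n.
have [u v e _] := egcdnP n m0.
have zvn : z ^+ (v * n) = 1 by rewrite mulnC exprM zn expr1n.
by rewrite -[LHS]mul1r -zvn -exprD -e mulnC exprM zm expr1n.
Qed.

Lemma dvd_exp1 (R : nzRingType) (m n : nat) (z : R) :
  (m %| n)%N -> z ^+ m = 1 -> z ^+ n = 1.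
Proof. by move=> /dvdnP[q ->] zm; rewrite mulnC exprM zm expr1n. Qed.

(** The exponents [1 + j * (M * p ^ s.+1)], [j < p], are units modulo [N], so these powers of [z]
    share its trace, while they add up to a vanishing geometric sum. For a prime [p] not dividing
    [M] this concerns orders divisible by [p ^ 2], where [mu] vanishes. *)
Lemma unit_trace_high (N p a M s : nat) (z : algC) :
  N = (p ^ a * M)%N -> (0 < N)%N ->
  z ^+ N = 1 -> z ^+ (M * p ^ s.+2) = 1 -> z ^+ (M * p ^ s.+1) != 1 ->
  unit_trace N z = 0.
Proof.
move=> eN N_gt0 zN z1 z0.
have s0 : \sum_(j < p) z ^+ (1 + j * (M * p ^ s.+1)) = 0.
  by apply: sum_expr_step; rewrite // -mulnA -expnSr.
have : \sum_(j < p) unit_trace N (z ^+ (1 + j * (M * p ^ s.+1))) = 0.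
  rewrite exchange_big /= big1 // => t ct.
  under eq_bigr do rewrite exprAC.
  apply: sum_expr_step.
    by rewrite -exprM -mulnA -expnSr mulnC exprM z1 expr1n.
  apply: contraNneq z0; rewrite -exprM => zt.
  have := exp_mod_gcd zt zN.
  move=> g1; apply/eqP; apply: dvd_exp1 g1.
  by rewrite gcdnC Gauss_gcdr 1?coprime_sym // dvdn_gcdr.
have cop (j : nat) : coprime (1 + j * (M * p ^ s.+1)) N.
  have c1 : coprime (1 + j * (M * p ^ s.+1)) (M * p ^ s.+1).
    by rewrite addnC coprime_sym /coprime gcdnMDl gcdn1.
  apply: (@coprime_dvdr _ ((M * p ^ s.+1) ^ a.+1)); last exact: coprimeXr.
  rewrite eN expnMn [(p ^ a * M)%N]mulnC; apply: dvdn_mul.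
    by rewrite expnS dvdn_mulr.
  by rewrite -expnM dvdn_exp2l // mulSn mulnS; lia.
under eq_bigr do rewrite (unit_trace_exp N_gt0 zN (cop _)).
rewrite sumr_const => /eqP; rewrite mulrn_eq0 cardT size_enum_ord.
case/orP => [/eqP p0|/eqP //].
(* [p] is not assumed prime; [p = 0] would make the exponent in [z0] zero. *)
by move: z1; rewrite p0 exp0n // muln0; move: z0; rewrite p0 exp0n ?muln0 ?expr0 ?eqxx.
Qed.

(** Exactly one of the exponents [1 + j * M], [j < p], is divisible by [p], as [M] is invertible
    modulo [p]; it serves as [u]. The other [p - 1] are units modulo [N], and the sum over all [j]
    is a vanishing geometric sum. *)
Lemma unit_trace_low (N p a M : nat) (z : algC) :
  prime p -> coprime p M -> N = (p ^ a * M)%N -> (0 < N)%N ->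
  z ^+ N = 1 -> z ^+ (M * p) = 1 -> z ^+ M != 1 ->
  exists2 u, z ^+ u ^+ M = 1 & (p%:R - 1) * unit_trace N z = - unit_trace N (z ^+ u).
Proof.
move=> pp cpM eN N_gt0 zN z1 z0.
have p_gt0 := prime_gt0 pp.
have M_gt0 : (0 < M)%N by move: N_gt0; rewrite eN muln_gt0 => /andP[].
have [km kn e _] := egcdnP p M_gt0.
have {}e : (km * M = kn * p + 1)%N by rewrite e gcdnC (eqP cpM).
have [j0 hj0] : exists j0 : 'I_p, (p %| 1 + j0 * M)%N.
  (* [km] inverts [M] modulo [p], so [km * p.-1] represents [- 1 / M]. *)
  exists (Ordinal (ltn_pmod (km * p.-1) p_gt0)) => /=.
  rewrite /dvdn -modnDmr modnMml modnDmr mulnAC e mulnDl mul1n.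
  by rewrite addnCA add1n prednK // mulnAC -mulSnr modnMl.
have cop (j : 'I_p) : j != j0 -> coprime (1 + j * M) N.
  move=> nj; have c1 : coprime (1 + j * M) M.
    by rewrite addnC coprime_sym /coprime gcdnMDl gcdn1.
  rewrite eN coprimeMr c1 andbT; apply: coprimeXr.
  rewrite coprime_sym prime_coprime //; apply: contra nj => dj.
  have : j * M = j0 * M %[mod p].
    by apply/eqP; rewrite -(eqn_modDl 1) (eqP dj) (eqP hj0).
  by move/eqP; rewrite ![(_ * M)%N]mulnC eqn_mod_mull 1?coprime_sym // !modn_small.
exists (1 + j0 * M)%N.
  by rewrite -exprM; apply: dvd_exp1 z1; rewrite mulnC dvdn_mul.
have : \sum_(j < p) unit_trace N (z ^+ (1 + j * M)) = 0.
  rewrite exchange_big /= big1 // => t ct.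
  under eq_bigr do rewrite exprAC.
  apply: sum_expr_step.
    by rewrite -exprM mulnC exprM z1 expr1n.
  apply: contraNneq z0; rewrite -exprM => zt.
  have := exp_mod_gcd zt zN.
  move=> g1; apply/eqP; apply: dvd_exp1 g1.
  by rewrite gcdnC Gauss_gcdr 1?coprime_sym // dvdn_gcdr.
rewrite (bigD1 j0) //= (eq_bigr (fun=> unit_trace N z)); last first.
  by move=> j nj; rewrite unit_trace_exp ?cop.
rewrite sumr_const (eq_card (_ : _ =i predC1 j0)) // cardC1 card_ord.
move/eqP; rewrite addrC addr_eq0 => /eqP <-.
by rewrite -[p in p%:R]prednK // -[in LHS]addn1 natrD addrK mulr_natl.
Qed.

Lemma prime_level (R : nzRingType) (p M a : nat) (z : R) :
  z ^+ (p ^ a * M) = 1 ->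
  z ^+ M = 1 \/
  exists2 s, (s < a)%N & z ^+ (M * p ^ s.+1) = 1 /\ z ^+ (M * p ^ s) != 1.
Proof.
elim: a => [|a IHa]; first by rewrite mul1n; left.
move=> za; have [za1|za1] := eqVneq (z ^+ (p ^ a * M)) 1.
  by case: (IHa za1) => [|[s lt_s]]; [left | right; exists s => //; apply: ltnW].
by right; exists a => //; rewrite mulnC za mulnC za1.
Qed.

Lemma prime_decomp_coprime (p N : nat) :
  prime p -> (0 < N)%N -> exists a M, N = (p ^ a * M)%N /\ coprime p M.
Proof.
move=> pp N_gt0; have [M cpM eN] := pfactor_coprime pp N_gt0.
by exists (logn p N), M; rewrite mulnC.
Qed.

(** Induction on an exponent [n] killing [z]: for a prime [p] dividing [n], unless a proper divisor
    of [n] already kills [z], the trace is [0] or [- 1 / (p - 1)] times that of a power of [z]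
    killed by a proper divisor of [n]. *)
Lemma unit_trace_rat (N : nat) (z : algC) :
  (0 < N)%N -> z ^+ N = 1 ->
  exists r : rat, unit_trace N z = ratr r * unit_trace N 1.
Proof.
move=> N_gt0; suff hN n : (n %| N)%N -> z ^+ n = 1 -> exists r : rat,
    unit_trace N z = ratr r * unit_trace N 1 by exact: hN.
elim/ltn_ind: n z => n IHn z n_dvd zn.
have n_gt0 := dvdn_gt0 N_gt0 n_dvd.
have zN := dvd_exp1 n_dvd zn.
have [n1|n_neq1] := eqVneq n 1%N.
  by exists 1; rewrite rmorph1 mul1r; move: zn; rewrite n1 expr1 => ->.
have pp : prime (pdiv n) by rewrite pdiv_prime // ltn_neqAle eq_sym n_neq1.
set p := pdiv n in pp.
have [a [M [eN cpM]]] := prime_decomp_coprime pp N_gt0.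
have IH (y : algC) : y ^+ M = 1 -> y ^+ n = 1 ->
    exists r : rat, unit_trace N y = ratr r * unit_trace N 1.
  move=> yM yn; apply: (IHn (gcdn M n)); last exact: exp_mod_gcd.
    rewrite ltn_neqAle (dvdn_leq n_gt0 (dvdn_gcdr _ _)) andbT.
    apply: contraTneq cpM => eg; rewrite prime_coprime // negbK.
    by apply: dvdn_trans (pdiv_dvd n) _; rewrite -eg dvdn_gcdl.
  exact: dvdn_trans (dvdn_gcdr _ _) n_dvd.
have zN' : z ^+ (p ^ a * M) = 1 by rewrite -eN.
have [zM|[[|s] _ [z1 z0]]] := prime_level zN'; first exact: IH.
  rewrite expn1 in z1; rewrite expn0 muln1 in z0.
  have [u zuM e] := unit_trace_low pp cpM eN N_gt0 zN z1 z0.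
  have [|r er] := IH (z ^+ u) zuM; first by rewrite exprAC zn expr1n.
  have p1 : (p%:R - 1 : rat) != 0.
    by rewrite subr_eq0 pnatr_eq1 neq_ltn prime_gt1 ?orbT.
  exists (- r / (p%:R - 1)); apply: (mulfI (_ : (p%:R - 1 : algC) != 0)).
    by rewrite subr_eq0 pnatr_eq1 neq_ltn prime_gt1 ?orbT.
  rewrite e er -mulNr -raddfN /=.
  have -> : (p%:R - 1 : algC) = ratr (p%:R - 1) by rewrite rmorphB rmorph1 rmorph_nat.
  by rewrite mulrA -rmorphM /= mulrCA divff ?mulr1.
exists 0; rewrite rmorph0 mul0r.
exact: (unit_trace_high eN N_gt0 zN z1 z0).
Qed.

(* On a root of order [n] dividing [N] this is [mu n / phi n]. *)
Definition galois_mean (N : nat) (z : algC) : rat :=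
  getCrat (unit_trace N z / unit_trace N 1).

Lemma galois_meanE (N : nat) (z : algC) :
  (0 < N)%N -> z ^+ N = 1 ->
  ratr (galois_mean N z) = unit_trace N z / unit_trace N 1.
Proof.
move=> N_gt0 zN; apply: getCratK; have [r ->] := unit_trace_rat N_gt0 zN.
by rewrite mulfK ?unit_trace1_neq0 // Crat_rat.
Qed.

Lemma galois_mean1 (N : nat) : (0 < N)%N -> galois_mean N 1 = 1.
Proof.
move=> N_gt0; apply: (fmorph_inj (@ratr algC)) => /=.
by rewrite galois_meanE ?expr1n // divff ?unit_trace1_neq0 ?rmorph1.
Qed.

Lemma galois_mean_high (N p a M s : nat) (z : algC) :
  N = (p ^ a * M)%N -> (0 < N)%N ->
  z ^+ N = 1 -> z ^+ (M * p ^ s.+2) = 1 -> z ^+ (M * p ^ s.+1) != 1 ->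
  galois_mean N z = 0.
Proof.
move=> eN N_gt0 zN z1 z0; apply: (fmorph_inj (@ratr algC)) => /=.
by rewrite galois_meanE // (unit_trace_high eN N_gt0 zN z1 z0) mul0r rmorph0.
Qed.

Lemma galois_mean_low (N p a M : nat) (z : algC) :
  prime p -> coprime p M -> N = (p ^ a * M)%N -> (0 < N)%N ->
  z ^+ N = 1 -> z ^+ (M * p) = 1 -> z ^+ M != 1 ->
  exists2 u, z ^+ u ^+ M = 1 &
    (p%:R - 1) * galois_mean N z = - galois_mean N (z ^+ u).
Proof.
move=> pp cpM eN N_gt0 zN z1 z0.
have [u zuM e] := unit_trace_low pp cpM eN N_gt0 zN z1 z0.
exists u => //; apply: (fmorph_inj (@ratr algC)) => /=.
rewrite rmorphN rmorphM rmorphB rmorph1 rmorph_nat /= !galois_meanE //.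
  by rewrite mulrA e mulNr.
by rewrite exprAC zN expr1n.
Qed.

Lemma galois_mean_bound (N : nat) (z : algC) :
  (0 < N)%N -> z ^+ N = 1 -> `|galois_mean N z| <= 1.
Proof.
move=> N_gt0 zN; rewrite -(ler_rat algC) rmorph1 ratr_norm galois_meanE //.
have tr1 : unit_trace N 1 = (\sum_(t < N | coprime t N) 1)%:R.
  rewrite natr_sum /unit_trace; apply: eq_bigr => t _.
  by rewrite expr1n.
have tr1_gt0 : 0 < unit_trace N 1.
  by rewrite lt0r unit_trace1_neq0 // tr1 ler0n.
rewrite normf_div [`|unit_trace N 1|]gtr0_norm // ler_pdivrMr // mul1r.
apply: le_trans (ler_norm_sum _ _ _) _.
apply: ler_sum => t _; rewrite expr1n normrX.
have -> : `|z| = 1.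
  by apply/eqP; rewrite -(pexpr_eq1 N_gt0 (normr_ge0 z)) -normrX zN normr1.
by rewrite expr1n.
Qed.

(** The eigenvalue of the adjacency operator on the character [g |-> z ^ g]. *)
Definition eigsum (l : seq nat) (z : algC) : algC :=
  \sum_(d <- l) (z ^+ d + z ^- d).

(** An automorphism of [algC] that sends [z] to [z ^+ u] fixes the integer [q]. *)
Lemma eigsum_galois (N u : nat) (l : seq nat) (z : algC) (q : int) :
  coprime u N -> z ^+ N = 1 -> eigsum l z = q%:~R -> eigsum l (z ^+ u) = q%:~R.
Proof.
move=> cuN zN ez; have [s sE] := Qn_aut_exists cuN.
rewrite -[RHS](rmorph_int s) -ez rmorph_sum; apply: eq_bigr => d _.
by rewrite rmorphD fmorphV !rmorphXn /= sE.
Qed.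

(** The conjugate equations are summed over all units modulo [N]; [z ^+ d] and [z ^- d] have equal
    traces, whence the factor [2]. *)
Lemma galois_mean_sum (N : nat) (l : seq nat) (z : algC) (q : int) :
  (0 < N)%N -> z ^+ N = 1 -> eigsum l z = q%:~R ->
  2 * \sum_(d <- l) galois_mean N (z ^+ d) = q%:~R.
Proof.
move=> N_gt0 zN ez; apply: (fmorph_inj (@ratr algC)) => /=.
rewrite rmorphM rmorph_sum /= ratr_int rmorph_nat.
have zdN d : z ^+ d ^+ N = 1 by rewrite exprAC zN expr1n.
under eq_bigr do rewrite galois_meanE //.
rewrite -mulr_suml mulrA; apply: (canLR (mulfK (unit_trace1_neq0 N_gt0))).
transitivity (\sum_(d <- l) \sum_(t < N | coprime t N) ((z ^+ d) ^+ t + (z ^- d) ^+ t)).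
  rewrite mulr_sumr; apply: eq_bigr => d _; rewrite big_split /=.
  by rewrite mulr_natl mulr2n -{2}(unit_traceV N_gt0 (zdN d)).
rewrite /unit_trace mulr_sumr.
rewrite exchange_big /=; apply: eq_bigr => t ct.
rewrite expr1n mulr1 -(eigsum_galois ct zN ez).
by apply: eq_bigr => d _; rewrite exprAC exprVn exprAC.
Qed.

Lemma galois_mean_level (N p a M s : nat) (z : algC) :
  prime p -> coprime p M -> N = (p ^ a * M)%N -> (0 < N)%N -> z ^+ N = 1 ->
  z ^+ (M * p ^ s.+1) = 1 -> z ^+ (M * p ^ s) != 1 ->
  `|galois_mean N z| * (p%:R - 1) <= 1.
Proof.
move=> pp cpM eN N_gt0 zN z1 z0; have p1 : (1 : rat) <= p%:R - 1.
  by rewrite lerBrDr -(natrD _ 1 1) ler_nat prime_gt1.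
case: s z1 z0 => [|s] z1 z0; last first.
  by rewrite (galois_mean_high eN N_gt0 zN z1 z0) normr0 mul0r.
rewrite expn1 in z1; rewrite expn0 muln1 in z0.
have [u zuM e] := galois_mean_low pp cpM eN N_gt0 zN z1 z0.
rewrite mulrC -[p%:R - 1]ger0_norm; last exact: le_trans p1.
rewrite -normrM e normrN galois_mean_bound //.
by rewrite exprAC zN expr1n.
Qed.

Lemma galois_mean_dvd_prime (N n p : nat) (z : algC) :
  (0 < N)%N -> (n %| N)%N -> n.-primitive_root z -> prime p -> (p %| n)%N ->
  `|galois_mean N z| * (p%:R - 1) <= 1.
Proof.
move=> N_gt0 nN prim_z pp pn.
have zN := dvd_exp1 nN (prim_expr_order prim_z).
have [a [M [eN cpM]]] := prime_decomp_coprime pp N_gt0.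
have zN' : z ^+ (p ^ a * M) = 1 by rewrite -eN.
have [zM|[s _ [z1 z0]]] := prime_level zN'.
  move/eqP: zM; rewrite -(prim_order_dvd prim_z) => nM.
  by move: cpM; rewrite prime_coprime // (dvdn_trans pn nM).
exact: (galois_mean_level pp cpM eN N_gt0 zN z1 z0).
Qed.

Lemma galois_mean_dvd_sqr (N n p : nat) (z : algC) :
  (0 < N)%N -> (n %| N)%N -> n.-primitive_root z -> prime p ->
  (p ^ 2 %| n)%N -> galois_mean N z = 0.
Proof.
move=> N_gt0 nN prim_z pp pn.
have zN := dvd_exp1 nN (prim_expr_order prim_z).
have [a [M [eN cpM]]] := prime_decomp_coprime pp N_gt0.
have zN' : z ^+ (p ^ a * M) = 1 by rewrite -eN.
have npM : ~~ (n %| M * p)%N.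
  apply: contraL cpM => nMp; rewrite prime_coprime // negbK.
  by rewrite -(dvdn_pmul2r (prime_gt0 pp)); apply: dvdn_trans nMp.
have [zM|[[|s] _ [z1 z0]]] := prime_level zN'.
- move: npM; rewrite (prim_order_dvd prim_z).
  by rewrite exprM zM expr1n eqxx.
- by move: npM; rewrite (prim_order_dvd prim_z) -[p in (_ * p)%N]expn1 z1 eqxx.
exact: (galois_mean_high eN N_gt0 zN z1 z0).
Qed.

(** * Roots of unity with markedly negative mean *)

Lemma galois_mean_int_trace (N : nat) (z : algC) (q : int) :
  (0 < N)%N -> z ^+ N = 1 -> z + z^-1 = q%:~R -> 2 * galois_mean N z = q%:~R.
Proof.
move=> N_gt0 zN ez; have := @galois_mean_sum N [:: 1%N] z q N_gt0 zN.
by rewrite /eigsum !big_seq1 expr1; apply.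
Qed.

Lemma galois_meanN1 (N : nat) :
  (0 < N)%N -> (-1 : algC) ^+ N = 1 -> galois_mean N (-1) = -1.
Proof.
move=> N_gt0 zN; have := galois_mean_int_trace (q := -2) N_gt0 zN.
rewrite invrN invr1 -opprD -[1 + 1]/(2%:R) rmorphN /= => /(_ erefl).
by rewrite rmorphN /= => e; apply: (mulfI (_ : 2 != 0 :> rat)); rewrite // e; ring.
Qed.

Lemma trace_neq0 (z : algC) (c : algC) :
  z != 0 -> z ^+ 2 - c * z + 1 = 0 -> z + z^-1 = c.
Proof.
move=> nz e; apply: (mulfI nz); rewrite mulrDr divff //.
by move/eqP: e; rewrite addrAC subr_eq0 -expr2 [z * c]mulrC => /eqP.
Qed.

Lemma root_of_unity_neq0 (N : nat) (z : algC) : (0 < N)%N -> z ^+ N = 1 -> z != 0.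
Proof.
move=> N_gt0 zN; apply: contra_eq_neq zN => ->.
by rewrite expr0n eqn0Ngt N_gt0 eq_sym oner_eq0.
Qed.

Lemma galois_mean_order3 (N : nat) (z : algC) :
  (0 < N)%N -> z ^+ N = 1 -> z ^+ 2 + z + 1 = 0 -> galois_mean N z = - 2^-1.
Proof.
move=> N_gt0 zN e; have nz := root_of_unity_neq0 N_gt0 zN.
have ez : z + z^-1 = (-1)%:~R.
  by apply: trace_neq0; rewrite // mulN1r opprK.
by have := galois_mean_int_trace N_gt0 zN ez; rewrite rmorphN /=; lra.
Qed.

Lemma sextic_factor (z : algC) : z ^+ 6 = 1 ->
  [\/ z = 1, z = -1, z ^+ 2 + z + 1 = 0 | z ^+ 2 - z + 1 = 0].
Proof.
move=> z6; have : (z - 1) * (z + 1) * (z ^+ 2 + z + 1) * (z ^+ 2 - z + 1) = 0.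
  by rewrite (_ : _ * _ = z ^+ 6 - 1); [rewrite z6 subrr | ring].
move/eqP; rewrite !mulf_eq0 -!orbA subr_eq0 addr_eq0.
by case/or4P => /eqP; [constructor 1 | constructor 2 | constructor 3 | constructor 4].
Qed.

(** Some prime has a larger exponent in [n] than in [m]. Used with [m = 6] and [m = 15]: a root of
    order [n] then has mean [0], or at most [1 / (p - 1)] in absolute value for a prime [p] not
    dividing [m]. *)
Lemma ndvdn_prime (n m : nat) :
  (0 < n)%N -> ~~ (n %| m)%N -> exists p,
  [/\ prime p, (p %| n)%N & ~~ (p %| m)%N || (p ^ 2 %| n)%N].
Proof.
move=> n_gt0 nm.
have [all_p|] := boolP (all (fun p => (p %| m)%N && ~~ (p ^ 2 %| n)%N) (primes n)).
  have m_gt0 : (0 < m)%N by case: m nm {all_p}; rewrite ?dvdn0.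
  case/negP: nm; apply/(dvdn_partP _ n_gt0) => p pn.
  have /andP[pm] := allP all_p p pn.
  move: pn; rewrite mem_primes => /and3P[pp _ pn].
  rewrite pfactor_dvdn // -ltnNge ltnS => l1.
  by rewrite p_part; case: (logn p n) l1 => [|[|]] // _; rewrite expn0 dvd1n.
case/allPn => p; rewrite mem_primes => /and3P[pp _ pn].
by rewrite negb_and negbK; exists p.
Qed.

(** Orders dividing [6] have means [1], [-1], [-1/2], [1/2]. Any other order is divisible by the
    square of a prime, which gives mean [0], or by a prime [p >= 5]. *)
Lemma galois_mean_cases (N : nat) (z : algC) :
  (0 < N)%N -> z ^+ N = 1 ->
  [\/ z = -1 /\ galois_mean N z = -1,
      z ^+ 2 + z + 1 = 0 /\ galois_mean N z = - 2^-1
    | - 4^-1 <= galois_mean N z].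
Proof.
move=> N_gt0 zN; have [n prim_z nN] := prim_order_exists N_gt0 zN.
have n_gt0 := prim_order_gt0 prim_z.
have [z6|n6] := boolP (n %| 6)%N.
  move: z6; rewrite (prim_order_dvd prim_z) => /eqP /sextic_factor[] e.
  - by constructor 3; rewrite e (galois_mean1 N_gt0); lra.
  - by constructor 1; split=> //; rewrite e galois_meanN1 // -e.
  - by constructor 2; split=> //; apply: galois_mean_order3.
  have ez : z + z^-1 = 1%:~R.
    by apply: trace_neq0; [apply: root_of_unity_neq0 zN | rewrite mul1r].
  by have := galois_mean_int_trace N_gt0 zN ez; constructor 3; lra.
have [p [pp pn /orP[p6|p2]]] := ndvdn_prime n_gt0 n6; constructor 3; last first.
  by rewrite (galois_mean_dvd_sqr N_gt0 nN prim_z pp p2); lra.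
have p5 : (5 <= p)%N by move: pp p6 {pn}; case: p => [|[|[|[|[|p]]]]].
have p4 : (4 : rat) <= p%:R - 1 by rewrite lerBrDr -(natrD _ 4 1) ler_nat.
have h5 := galois_mean_dvd_prime N_gt0 nN prim_z pp pn.
have := ler_wpM2l (normr_ge0 (galois_mean N z)) p4.
by have := ler_norm (- galois_mean N z); rewrite normrN; lra.
Qed.

(** The orders [1], [3], [5], [15] have means [1], [-1/2], [-1/4], [1/8]; any other odd order is
    divisible by the square of a prime or by a prime [p >= 7]. *)
Lemma galois_mean_odd_cases (N m : nat) (z : algC) :
  (0 < N)%N -> z ^+ N = 1 -> odd m -> z ^+ m = 1 ->
  [\/ z = 1 /\ galois_mean N z = 1,
      z ^+ 2 + z + 1 = 0 /\ galois_mean N z = - 2^-1,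
      z ^+ 5 = 1 /\ galois_mean N z = - 4^-1
    | `|galois_mean N z| <= 6^-1].
Proof.
move=> N_gt0 zN odd_m zm; have [n prim_z nN] := prim_order_exists N_gt0 zN.
have n_gt0 := prim_order_gt0 prim_z.
have nm : (n %| m)%N by rewrite (prim_order_dvd prim_z) zm.
have [n15|n15] := boolP (n %| 15)%N; last first.
  have [p [pp pn /orP[p15|p2]]] := ndvdn_prime n_gt0 n15; constructor 4; last first.
    by rewrite (galois_mean_dvd_sqr N_gt0 nN prim_z pp p2) normr0; lra.
  have p_odd : odd p by apply: dvdn_odd (dvdn_trans pn nm) odd_m.
  have p7 : (7 <= p)%N by move: pp p15 p_odd {pn}; case: p => [|[|[|[|[|[|[|p]]]]]]].
  have p6 : (6 : rat) <= p%:R - 1 by rewrite lerBrDr -(natrD _ 6 1) ler_nat.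
  have h7 := galois_mean_dvd_prime N_gt0 nN prim_z pp pn.
  by have := ler_wpM2l (normr_ge0 (galois_mean N z)) p6; lra.
have z15 : z ^+ 15 = 1 by apply/eqP; rewrite -(prim_order_dvd prim_z).
have mean1 := galois_mean1 N_gt0.
(* Strips the prime [p] from a root of order dividing [15 = p * q], unless the order already divides
   [q]. *)
have {n prim_z nN n_gt0 nm n15} step (y : algC) p q : y ^+ N = 1 -> y ^+ 15 = 1 ->
    prime p -> prime q -> coprime p q -> (p * q = 15)%N ->
    y ^+ q = 1 \/ exists2 u, y ^+ u ^+ q = 1 &
    (p%:R - 1) * galois_mean N y = - galois_mean N (y ^+ u).
  move=> yN y15 pp pq cpq pq15; have [a [M [eN cpM]]] := prime_decomp_coprime pp N_gt0.
  have red (x : algC) : x ^+ 15 = 1 -> x ^+ M = 1 -> x ^+ q = 1.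
    move=> x15 xM; apply: dvd_exp1 (exp_mod_gcd x15 xM).
    by rewrite -pq15 gcdnC Gauss_gcdr ?dvdn_gcdr // coprime_sym.
  have [/(red _ y15)|yM] := eqVneq (y ^+ M) 1; first by left.
  right; have yMp : y ^+ (M * p) = 1.
    apply: dvd_exp1 (exp_mod_gcd y15 yN).
    apply: (@dvdn_trans (p * gcdn q N)).
      by rewrite muln_gcdr pq15 dvdn_gcd dvdn_gcdl dvdn_mull ?dvdn_gcdr.
    rewrite mulnC dvdn_mul // eN Gauss_gcdr ?dvdn_gcdr //.
    by rewrite coprimeXr // coprime_sym.
  have [u yuM e] := galois_mean_low pp cpM eN N_gt0 yN yMp yM.
  by exists u => //; apply: red => //; rewrite exprAC y15 expr1n.
have [z3|[u zu3 e5]] := step z 5%N 3%N zN z15 isT isT isT erefl.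
  have : (z - 1) * (z ^+ 2 + z + 1) = 0.
    by rewrite (_ : _ * _ = z ^+ 3 - 1); [rewrite z3 subrr | ring].
  move/eqP; rewrite mulf_eq0 subr_eq0 => /orP[]/eqP e.
    by constructor 1; rewrite {2}e mean1.
  by constructor 2; rewrite (galois_mean_order3 N_gt0 zN e).
have [z5|[v zv5 e3]] := step z 3%N 5%N zN z15 isT isT isT erefl.
  constructor 3; split=> //.
  have zu1 : z ^+ u = 1.
    have z5u : (z ^+ u) ^+ 5 = 1 by rewrite exprAC z5 expr1n.
    by have := exp_mod_gcd zu3 z5u; rewrite expr1.
  by move: e5; rewrite zu1 mean1; lra.
constructor 4; have zuN w : z ^+ w ^+ N = 1 by rewrite exprAC zN expr1n.
have h5 : galois_mean N z = - 4^-1 \/ galois_mean N z = 8^-1.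
  have : (z ^+ u - 1) * ((z ^+ u) ^+ 2 + z ^+ u + 1) = 0.
    by rewrite (_ : _ * _ = z ^+ u ^+ 3 - 1); [rewrite zu3 subrr | ring].
  move/eqP; rewrite mulf_eq0 subr_eq0 => /orP[]/eqP e; move: e5.
    by rewrite e mean1; left; lra.
  by rewrite (galois_mean_order3 N_gt0 (zuN u) e); right; lra.
(* The remaining order is [15]. A mean [-1/4] would, after stripping [3], leave a fifth root of
   unity of mean [1/2], whereas such means are [1] or [-1/4]. *)
have [em|em] := h5; last by rewrite em ger0_norm; lra.
have zv15 : z ^+ v ^+ 15 = 1 by rewrite exprAC z15 expr1n.
have [zv3|[w zvw3 e1]] := step (z ^+ v) 5%N 3%N (zuN v) zv15 isT isT isT erefl.
  have := exp_mod_gcd zv3 zv5; rewrite expr1 => zv1.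
  by move: e3; rewrite zv1 mean1 em; lra.
have zvw5 : z ^+ v ^+ w ^+ 5 = 1 by rewrite exprAC zv5 expr1n.
have := exp_mod_gcd zvw3 zvw5; rewrite expr1 => zvw1.
by move: e1 e3; rewrite zvw1 mean1 em; lra.
Qed.

(** * Levels in the Fourier support *)

(** This is [(X^(m * p) - 1) / (X^m - 1)]. For a prime [p] not dividing [M > 0] and [m = M * p ^ s],
    its complex roots are the roots of unity of order dividing [m * p] with [p]-adic valuation
    [s.+1]; its value at [1] is [p]. *)
Definition geom_poly (R : nzRingType) (p m : nat) : {poly R} :=
  \sum_(j < p) 'X^m ^+ j.

Lemma geom_polyE (R : comNzRingType) (p m : nat) :
  'X^(m * p) - 1 = ('X^m - 1) * geom_poly R p m.
Proof. by rewrite exprM subrX1. Qed.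

Lemma geom_poly_monic (p m : nat) :
  (0 < p)%N -> (0 < m)%N -> geom_poly int p m \is monic.
Proof.
move=> p_gt0 m_gt0; have := monic_Xn_sub_1 int (_ : 0 < m * p)%N.
rewrite muln_gt0 m_gt0 geom_polyE => /(_ p_gt0).
by rewrite monicMl // monic_Xn_sub_1.
Qed.

Lemma map_geom_poly (p m : nat) :
  map_poly intr (geom_poly int p m) = geom_poly algC p m.
Proof.
by rewrite rmorph_sum; apply: eq_bigr => j _; rewrite !rmorphXn /= map_polyX.
Qed.

Lemma horner_geom_poly (R : comNzRingType) (p m : nat) (z : R) :
  (geom_poly R p m).[z] = \sum_(j < p) z ^+ (m * j).
Proof.
by rewrite horner_sum; apply: eq_bigr => j _; rewrite -exprM hornerXn.
Qed.

Lemma root_geom_poly (p m : nat) (z : algC) :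
  (0 < p)%N -> root (geom_poly algC p m) z -> z ^+ (m * p) = 1 /\ z ^+ m != 1.
Proof.
move=> p_gt0 rz; split.
  apply/eqP; rewrite -subr_eq0; have /(congr1 (horner^~ z)) := geom_polyE algC p m.
  by rewrite hornerM (rootP rz) mulr0 !hornerE => ->.
apply: contraTneq rz => zm; rewrite rootE horner_geom_poly.
under eq_bigr do rewrite exprM zm expr1n.
by rewrite sumr_const card_ord pnatr_eq0 -lt0n.
Qed.

Lemma prod_geom_poly (R : comNzRingType) (p M a : nat) :
  'X^(p ^ a * M) - 1 =
  ('X^M - 1) * \prod_(s < a) geom_poly R p (M * p ^ s).
Proof.
elim: a => [|a IHa]; first by rewrite mul1n big_ord0 mulr1.
rewrite big_ord_recr /= mulrA -IHa mulnC expnSr mulnA geom_polyE.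
by rewrite [(M * _)%N]mulnC.
Qed.

(** [X^N - 1] is separable, so inclusion of roots gives divisibility over [algC], which descends to
    the rationals, and to the integers because [Q] is monic. *)
Lemma dvdp_separable_roots (N : nat) (Q U : {poly int}) :
  (0 < N)%N -> Q \is monic ->
  map_poly intr Q %| ('X^N - 1 : {poly algC}) ->
  (forall z : algC, root (map_poly intr Q) z -> root (map_poly intr U) z) ->
  exists W : {poly int}, U = Q * W.
Proof.
move=> N_gt0 monQ QN QU; have [w prim_w] := C_prim_root_exists N_gt0.
have QUC : map_poly intr Q %| (map_poly intr U : {poly algC}).
  move: QN; rewrite -(factor_Xn_sub_1 prim_w).
  rewrite -(big_map (fun i => w ^+ i) xpredT (fun x => 'X - x%:P)).
  case/dvdp_prod_XsubC => m eQ; rewrite (eqp_dvdl _ eQ).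
  apply: uniq_roots_dvdp.
    apply/allP => x xm; apply: QU; rewrite (eqp_root eQ).
    by rewrite root_prod_XsubC.
  rewrite uniq_rootsE mask_uniq // map_inj_in_uniq ?iota_uniq //.
  move=> i j; rewrite !mem_index_iota /= => lt_iN lt_jN /eqP.
  by rewrite (eq_prim_root_expr prim_w) !modn_small // => /eqP.
have intrC (P : {poly int}) :
    map_poly intr P = map_poly ratr (map_poly intr P : {poly rat}) :> {poly algC}.
  rewrite -map_poly_comp; apply: eq_map_poly => x /=.
  by rewrite ratr_int.
have QUq : Q %| U.
  by rewrite -dvdp_rat_int -(dvdp_map (@ratr algC)) -!intrC.
by have [W ->] := dvdpP_int QUq; exists W; rewrite zprimitive_monic.
Qed.

(** The product of the factors [geom_poly] over the levels outside [E] divides [U], and each factor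
    takes the value [p] at [1]. *)
Lemma dvd_levels (p M a : nat) (E : seq nat) (U : {poly int}) :
  (0 < p)%N -> (0 < M)%N ->
  (forall (s : nat) (z : algC), (s < a)%N -> s \notin E ->
     z ^+ (M * p ^ s.+1) = 1 -> z ^+ (M * p ^ s) != 1 ->
     root (map_poly intr U) z) ->
  exists x : int, U.[1] = (p ^ (a - size E))%:R * x.
Proof.
move=> p_gt0 M_gt0 hU.
pose Q := \prod_(s < a | (s : nat) \notin E) geom_poly int p (M * p ^ s).
have N_gt0 : (0 < p ^ a * M)%N by rewrite muln_gt0 expn_gt0 p_gt0.
have monQ : Q \is monic.
  apply: monic_prod => s _.
  by rewrite geom_poly_monic // muln_gt0 expn_gt0 p_gt0 M_gt0.
have mapQ : map_poly intr Q =
    \prod_(s < a | (s : nat) \notin E) geom_poly algC p (M * p ^ s).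
  by rewrite rmorph_prod; apply: eq_bigr => s _; apply: map_geom_poly.
have [||W ->] := @dvdp_separable_roots _ Q U N_gt0 monQ.
- rewrite prod_geom_poly mapQ dvdp_mull //.
  rewrite [\prod_(s < a) _](bigID (fun s : 'I_a => (s : nat) \notin E)) /=.
  by rewrite dvdp_mulr.
- move=> z; rewrite mapQ rootE horner_prod => /prodf_eq0[s sE rz].
  have [z1 z0] := root_geom_poly p_gt0 rz.
  by apply: (hU s); rewrite // expnSr mulnA.
rewrite hornerM horner_prod.
have -> : \prod_(s < a | (s : nat) \notin E) (geom_poly int p (M * p ^ s)).[1] =
    (p ^ #|[pred s : 'I_a | (s : nat) \notin E]|)%:R.
  rewrite natrX -prodr_const; apply: eq_big => // s _.
  rewrite horner_geom_poly; under eq_bigr do rewrite expr1n.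
  by rewrite sumr_const card_ord.
(* Only an inequality: [E] may have repetitions or members not below [a]. *)
have le_card : (a - size E <= #|[pred s : 'I_a | (s : nat) \notin E]|)%N.
  rewrite leq_subLR -[X in (X <= _)%N](card_ord a).
  rewrite -(cardC [pred s : 'I_a | (s : nat) \in E]) leq_add //.
  rewrite cardE -(size_map val); apply: uniq_leq_size.
    by rewrite map_inj_uniq ?enum_uniq //; apply: val_inj.
  by move=> x /mapP[s]; rewrite mem_enum => + ->.
rewrite -(subnK le_card) expnD natrM mulrC mulrA.
by eexists; rewrite [RHS]mulrC.
Qed.

(** The equation [A f = c + (2 k - (b + c)) f] for the black indicator, with [k = size l], arranged
    without subtraction so as to live in [nat]. *)
Definition balanced (l : seq nat) (b c : nat) (f : int -> bool) : Prop :=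
  forall g : int,
  (\sum_(d <- l) (f (g + d%:Z)%R + f (g - d%:Z)%R) + (b + c) * f g
   = c + 2 * size l * f g)%N.

Lemma fourier_shift (N d : nat) (F : int -> algC) (z : algC) :
  (forall g, F (g + N%:Z) = F g) -> z ^+ N = 1 ->
  z ^+ d * (\sum_(g < N) F (g%:Z + d%:Z) * z ^+ g) = \sum_(g < N) F g%:Z * z ^+ g.
Proof.
move=> FN zN; elim: d F FN => [|d IHd] F FN.
  by rewrite mul1r; apply: eq_bigr => g _; rewrite addr0.
rewrite exprSr -mulrA -[RHS](IHd F FN); congr (_ * _).
have {}FN g : F (g + d%:Z + N%:Z) = F (g + d%:Z) by rewrite FN.
case: N zN FN {IHd} => [|N] zN FN; first by rewrite !big_ord0 mulr0.
rewrite big_ord_recr [RHS]big_ord_recl /= mulrDr [RHS]addrC.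
congr (_ + _).
  rewrite mulr_sumr; apply: eq_bigr => i _.
  rewrite mulrCA -exprS; congr (F _ * _).
  by rewrite /= /bump; lia.
(* By periodicity the last term of the shifted sum is the original term at [0]. *)
rewrite mulrCA -exprS zN mulr1 expr0 mulr1.
have := FN 0; rewrite !add0r => <-; congr F.
by lia.
Qed.

Lemma fourier_shiftN (N d : nat) (F : int -> algC) (z : algC) :
  (forall g, F (g + N%:Z) = F g) -> z ^+ N = 1 ->
  \sum_(g < N) F (g%:Z - d%:Z) * z ^+ g =
  z ^+ d * (\sum_(g < N) F g%:Z * z ^+ g).
Proof.
move=> FN zN; rewrite -(@fourier_shift N d (fun g => F (g - d%:Z)) z) //.
  by congr (_ * _); apply: eq_bigr => g _; rewrite addrK.
by move=> g; rewrite addrAC FN.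
Qed.

(** Shifts become multiplications under the Fourier transform. For [z != 1] the right-hand side
    vanishes, so either the transform of [f] is [0] at [z] or [eigsum l z] equals
    [2 k - (b + c)]. *)
Lemma fourier_balanced (N b c : nat) (l : seq nat) (f : int -> bool) (z : algC) :
  (0 < N)%N -> (forall g, f (g + N%:Z) = f g) -> balanced l b c f ->
  z ^+ N = 1 ->
  (eigsum l z + (b + c)%:R - (2 * size l)%:R) * (\sum_(g < N) (f g%:Z)%:R * z ^+ g)
  = c%:R * (\sum_(g < N) z ^+ g).
Proof.
move=> N_gt0 fN fbal zN; pose F g : algC := (f g)%:R.
have FN g : F (g + N%:Z) = F g by rewrite /F fN.
have nz := root_of_unity_neq0 N_gt0 zN.
have -> : c%:R * (\sum_(g < N) z ^+ g) = \sum_(g < N)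
    (\sum_(d <- l) (F (g%:Z + d%:Z) + F (g%:Z - d%:Z))
     + ((b + c)%:R - (2 * size l)%:R) * F g%:Z) * z ^+ g.
  rewrite mulr_sumr; apply: eq_bigr => g _; congr (_ * _).
  have /(congr1 (fun n => n%:R : algC)) := fbal g%:Z.
  rewrite natrD natrM natr_sum [in RHS]natrD [in RHS]natrM.
  under eq_bigr do rewrite natrD.
  by rewrite mulrBl addrA -/(F _) => ->; rewrite addrK.
rewrite -addrA !mulrDl.
under [RHS]eq_bigr do rewrite mulrDl.
rewrite big_split /=; congr (_ + _); last first.
  by rewrite -mulrDl mulr_sumr; apply: eq_bigr => g _; rewrite -mulrA.
under [RHS]eq_bigr do rewrite mulr_suml.
rewrite exchange_big /= mulr_suml; apply: eq_bigr => d _.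
under [RHS]eq_bigr do rewrite mulrDl.
rewrite big_split /= mulrDl addrC; congr (_ + _).
  by rewrite fourier_shiftN.
by rewrite -(fourier_shift d FN zN) mulKf ?expf_neq0.
Qed.

Lemma sum_unity_root (R : idomainType) (N : nat) (z : R) :
  z ^+ N = 1 -> z != 1 -> \sum_(g < N) z ^+ g = 0.
Proof.
move=> zN z1; have := subrX1 z N; rewrite zN subrr => /esym/eqP.
by rewrite mulf_eq0 subr_eq0 (negPf z1) => /eqP.
Qed.

Lemma eigsum1 (l : seq nat) : eigsum l 1 = (2 * size l)%:R.
Proof.
rewrite /eigsum; under eq_bigr do rewrite expr1n invr1 -[1 + 1]/(2%:R : algC).
by rewrite big_const_seq count_predT iter_addr_0 mulrnA.
Qed.

(* The two conditions on [z] say that its order has [p]-adic valuation [s.+1]: if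
   only the [s] in [E] occur in the Fourier support of [f], then the density
   [c / (b + c)] has [p]-adic valuation at least [- size E]. *)
Lemma level_bound (p M a N b c : nat) (l E : seq nat) (f : int -> bool) :
  prime p -> N = (p ^ a * M)%N -> (0 < M)%N -> coprime p M -> coprime p c ->
  (forall g, f (g + N%:Z) = f g) -> balanced l b c f ->
  (forall (s : nat) (z : algC), (s < a)%N -> s \notin E ->
     z ^+ (M * p ^ s.+1) = 1 -> z ^+ (M * p ^ s) != 1 ->
     eigsum l z != (2 * size l)%:R - (b + c)%:R) ->
  ~~ (p ^ (size E).+1 %| b + c)%N.
Proof.
move=> pp eN M_gt0 cpM cpc fN fbal hE.
have p_gt0 := prime_gt0 pp.
have N_gt0 : (0 < N)%N by rewrite eN muln_gt0 expn_gt0 p_gt0.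
(* Values of [U] at roots of unity are the Fourier coefficients of [f]; [U.[1]] counts the black
   vertices in a period. *)
pose U : {poly int} := \sum_(g < N) (f g%:Z)%:R *: 'X^g.
have UC (z : algC) : (map_poly intr U).[z] = \sum_(g < N) (f g%:Z)%:R * z ^+ g.
  rewrite rmorph_sum horner_sum; apply: eq_bigr => g _ /=.
  by rewrite map_polyZ map_polyXn hornerZ hornerXn rmorph_nat.
have U1 : U.[1] = (\sum_(g < N) f g%:Z)%:Z.
  rewrite horner_sum -natz natr_sum; apply: eq_bigr => g _.
  by rewrite hornerZ hornerXn expr1n mulr1 natz.
have eU : ((b + c) * \sum_(g < N) f g%:Z = c * N)%N.
  apply/eqP; rewrite -(eqr_nat algC) !natrM; apply/eqP.
  have := fourier_balanced N_gt0 fN fbal (expr1n _ N).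
  rewrite eigsum1 addrAC subrr add0r.
  under eq_bigr do rewrite expr1n mulr1.
  rewrite -natr_sum => ->; congr (_ * _).
  by under eq_bigr do rewrite expr1n; rewrite sumr_const card_ord.
have [|x] := @dvd_levels p M a E U p_gt0 M_gt0.
  move=> s z lt_sa sE z1 z0; rewrite rootE UC.
  have zN : z ^+ N = 1.
    by apply: dvd_exp1 z1; rewrite eN mulnC dvdn_mul // dvdn_exp2l.
  have z_neq1 : z != 1 by apply: contraNneq z0 => ->; rewrite expr1n.
  have /eqP := fourier_balanced N_gt0 fN fbal zN.
  rewrite sum_unity_root // mulr0 mulf_eq0 => /orP[|//].
  rewrite -addrA addr_eq0 opprB => /eqP e.
  by have := hE s z lt_sa sE z1 z0; rewrite e eqxx.
rewrite U1 natz => /(congr1 absz); rewrite abszM !absz_nat => ex.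
(* Otherwise [p ^ a.+1] divides [c * N], whose [p]-adic valuation is [a]. *)
apply/negP => p_bc; have : (p ^ a.+1 %| (b + c) * \sum_(g < N) f g%:Z)%N.
  apply: (@dvdn_trans (p ^ (size E).+1 * p ^ (a - size E))).
    by rewrite -expnD dvdn_exp2l // addSn ltnS -leq_subLR.
  by rewrite dvdn_mul // ex dvdn_mulr.
rewrite eU eN expnSr mulnCA dvdn_pmul2l ?expn_gt0 ?p_gt0 // Euclid_dvdM //.
by move: cpM cpc; rewrite !prime_coprime // => /negPf -> /negPf ->.
Qed.

(** * Reduction to periodic colourings *)

Lemma seq_max (l : seq nat) (d0 : nat) :
  d0 \in l -> exists2 L, L \in l & {in l, forall d, (d <= L)%N}.
Proof.
elim: l d0 => // d l IHl _ _; case: l IHl => [|d1 l] IHl.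
  by exists d; rewrite ?mem_head // => e; rewrite inE => /eqP ->.
have [L Ll maxL] := IHl d1 (mem_head _ _).
have [le_dL|lt_Ld] := leqP d L.
  exists L; first by rewrite in_cons Ll orbT.
  by move=> e; rewrite in_cons => /orP[/eqP ->|/maxL].
exists d; first exact: mem_head.
move=> e; rewrite in_cons => /orP[/eqP -> //|/maxL le_eL].
exact: leq_trans le_eL (ltnW lt_Ld).
Qed.

(** In the equation at [g + L] the only value outside the window is that at [g + 2 L], and its
    coefficient is the multiplicity of [L] in [l], which is positive. *)
Lemma balanced_window (l : seq nat) (b c L : nat) (f1 f2 : int -> bool) (g : int) :
  balanced l b c f1 -> balanced l b c f2 ->
  (0 < L)%N -> L \in l -> {in l, forall d, (d <= L)%N} ->
  (forall i, (i < 2 * L)%N -> f1 (g + i%:Z) = f2 (g + i%:Z)) ->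
  f1 (g + (2 * L)%:Z) = f2 (g + (2 * L)%:Z).
Proof.
move=> bal1 bal2 L_gt0 Ll maxL eqw.
pose h := g + L%:Z.
have eqw' (x : int) : (g <= x) && (x < g + (2 * L)%:Z) -> f1 x = f2 x.
  move=> hx; have -> : x = g + `|x - g|%N%:Z by lia.
  by apply: eqw; lia.
have split_sum (f : int -> bool) :
    (\sum_(d <- l) (f (h + d%:Z)%R + f (h - d%:Z)%R) =
     count_mem L l * f (h + L%:Z)%R +
     (\sum_(d <- l | d != L) f (h + d%:Z)%R + \sum_(d <- l) f (h - d%:Z)%R))%N.
  rewrite big_split /= (bigID (pred1 L)) /= -addnA; congr (_ + _)%N.
  rewrite (eq_bigr (fun=> nat_of_bool (f (h + L%:Z)))); last by move=> d /eqP ->.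
  by rewrite big_const_seq iter_addn_0 mulnC.
have e1 : (\sum_(d <- l | d != L) f1 (h + d%:Z)%R =
    \sum_(d <- l | d != L) f2 (h + d%:Z)%R)%N.
  rewrite big_seq_cond [RHS]big_seq_cond; apply: eq_bigr => d /andP[dl dL].
  by rewrite eqw' //; move: (maxL d dl) L_gt0 dL; rewrite /h; clear; lia.
have e2 : (\sum_(d <- l) f1 (h - d%:Z)%R = \sum_(d <- l) f2 (h - d%:Z)%R)%N.
  rewrite big_seq_cond [RHS]big_seq_cond; apply: eq_bigr => d /andP[dl _].
  by rewrite eqw' //; move: (maxL d dl) L_gt0; rewrite /h; clear; lia.
have m_gt0 : (0 < count_mem L l)%N by rewrite -has_count has_pred1.
have fh : f1 h = f2 h by apply: eqw'; move: L_gt0; rewrite /h; clear; lia.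
have := bal1 h; rewrite fh -(bal2 h) !split_sum e1 e2 => /addIn /addIn /eqP.
rewrite eqn_pmul2l // (_ : h + L%:Z = g + (2 * L)%:Z); last by rewrite /h; clear; lia.
by case: (f1 _) (f2 _) => [] [].
Qed.

(** There are [K] possible windows of length [2 * L]. Two of the [K.+1] windows starting at [g - K],
    ..., [g] coincide, so from the first of these on [f] has a period [p <= K]. It may vary with
    [g], but always divides [K!]. *)
Lemma balanced_periodic (l : seq nat) (b c : nat) (f : int -> bool) :
  balanced l b c f -> has (fun d => 0 < d)%N l ->
  exists2 N, (0 < N)%N & forall g, f (g + N%:Z) = f g.
Proof.
move=> bal /hasP[d0 d0l d0_gt0].
have [L Ll maxL] := seq_max d0l.
have L_gt0 := leq_trans d0_gt0 (maxL d0 d0l).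
pose W (g : int) : {ffun 'I_(2 * L) -> bool} :=
  [ffun i : 'I_(2 * L) => f (g + (i : nat)%:Z)].
have [K eK] : exists K, K = #|{ffun 'I_(2 * L) -> bool}| by eexists.
exists K`! => [|g]; first exact: fact_gt0.
pose g0 := g - K%:Z.
have [i [j [lt_ij le_jK eW]]] : exists i j,
    [/\ (i < j)%N, (j <= K)%N & W (g0 + i%:Z) = W (g0 + j%:Z)].
  have /injectivePn[i [j nij eW]] :
      ~~ injectiveb (fun i : 'I_K.+1 => W (g0 + (i : nat)%:Z)).
    apply/negP => /injectiveP /leq_card; by rewrite card_ord -eK ltnn.
  case: (ltngtP i j) => [lt_ij|lt_ji|/val_inj eij]; last by rewrite eij eqxx in nij.
    by exists i, j; split=> //; rewrite -ltnS.
  by exists j, i; split=> //; rewrite -ltnS.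
pose p := (j - i)%N.
have per n : (i <= n)%N -> f (g0 + n%:Z + p%:Z) = f (g0 + n%:Z).
  elim/ltn_ind: n => n IHn le_in.
  have [lt_n|le_n] := ltnP n (i + 2 * L).
    have lt2L : (n - i < 2 * L)%N by lia.
    have /ffunP /(_ (Ordinal lt2L)) := eW; rewrite !ffunE /= => e.
    transitivity (f (g0 + i%:Z + (n - i)%N%:Z)); last by congr f; lia.
    by rewrite e; congr f; rewrite /p; lia.
  have balp : balanced l b c (fun x => f (x + p%:Z)).
    move=> x; rewrite -(bal (x + p%:Z)); congr (_ + _)%N.
    by apply: eq_bigr => d _; congr (_ + _)%N; congr (nat_of_bool (f _)); lia.
  have := @balanced_window l b c L _ _ (g0 + (n - 2 * L)%N%:Z) balp bal L_gt0 Ll maxL.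
  have -> : g0 + (n - 2 * L)%N%:Z + (2 * L)%N%:Z = g0 + n%:Z by lia.
  apply=> k lt_k; have := IHn (n - 2 * L + k)%N.
  have -> : g0 + (n - 2 * L)%N%:Z + k%:Z = g0 + (n - 2 * L + k)%N%:Z by lia.
  by apply; lia.
have perm m n : (i <= n)%N -> f (g0 + n%:Z + (m * p)%N%:Z) = f (g0 + n%:Z).
  move=> le_in; elim: m => [|m IHm]; first by rewrite mul0n addr0.
  have := @per (n + m * p)%N (leq_trans le_in (leq_addr _ _)).
  have -> : g0 + (n + m * p)%N%:Z = g0 + n%:Z + (m * p)%N%:Z by rewrite PoszD addrA.
  by rewrite IHm => <-; rewrite mulSn addnC PoszD addrA.
have /dvdnP[m eKm] : (p %| K`!)%N by rewrite dvdn_fact // /p subn_gt0 lt_ij; lia.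
have -> : g = g0 + K%:Z by rewrite subrK.
by rewrite eKm perm //; lia.
Qed.

(** Lists without a nonzero member are excluded, as every number divides [0]. *)
Definition setwise_coprime (l : seq nat) : Prop :=
  forall q, all (dvdn q) l -> q = 1%N.

(** The colouring is restricted to the multiples of the gcd [D] of the distances and rescaled by
    [D]. *)
Lemma balanced_gcd (l : seq nat) (b c : nat) (f : int -> bool) :
  balanced l b c f -> has (fun d => 0 < d)%N l ->
  exists l' f', [/\ size l' = size l, balanced l' b c f',
    has (fun d => 0 < d)%N l' & setwise_coprime l'].
Proof.
move=> bal /hasP[d0 d0l d0_gt0]; pose D := \big[gcdn/0%N]_(d <- l) d.
have D_dvd d : d \in l -> (D %| d)%N.
  move=> dl; rewrite /D (big_rem d) //= dvdn_gcdl //.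
have D_gt0 : (0 < D)%N by apply: dvdn_gt0 (D_dvd d0 d0l).
exists [seq (d %/ D)%N | d <- l], (fun g => f (g * D%:Z)); split.
- by rewrite size_map.
- move=> g; rewrite size_map -(bal (g * D%:Z)); congr (_ + _)%N.
  rewrite big_map big_seq [RHS]big_seq; apply: eq_bigr => d /D_dvd Dd.
  by rewrite mulrDl mulrBl -PoszM divnK.
- by rewrite has_map; apply/hasP; exists d0; rewrite //= divn_gt0 // dvdn_leq ?D_dvd.
move=> q /allP hq; have : (q * D %| D)%N.
  rewrite {2}/D big_seq; elim/big_ind: _ => [|x y hx hy|d dl]; first exact: dvdn0.
    by rewrite dvdn_gcd hx.
  rewrite -[X in (_ %| X)%N](divnK (D_dvd d dl)) dvdn_pmul2r //.
  by apply: hq; apply: map_f.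
by rewrite -[X in (_ %| X)%N]mul1n dvdn_pmul2r // dvdn1 => /eqP.
Qed.

(** A black vertex has [2 k - b] black neighbours and a white one has [c]; one equation covers both
    cases. *)
Lemma perfect_balanced (k : nat) (l : k.-tuple nat) (b c : nat) :
  has_perfect_2colouring (circulant l) b c -> exists f, balanced l b c f.
Proof.
case=> f perf; exists (fun g => is_black (f g)) => g.
rewrite size_tuple; have := perf g.
have ew (s : seq int) : (count (fun w => is_white (f w)) s +
    count (fun w => is_black (f w)) s = size s)%N.
  rewrite -(count_predC (fun w => is_white (f w)) s); congr (_ + _)%N.
  by apply: eq_count => w /=; case: (f w).
have -> : (\sum_(d <- l) (is_black (f (g + d%:Z)%R) + is_black (f (g - d%:Z)%R)) =
    count (fun w => is_black (f w)) (circulant l g))%N.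
  have cnt (F : nat -> int) :
      (\sum_(d <- l) is_black (f (F d)) = count (fun d => is_black (f (F d))) l)%N.
    by rewrite -sum1_count [RHS]big_mkcond; apply: eq_bigr => d _; case: (f _).
  by rewrite big_split !cnt count_cat !count_map.
have := ew (circulant l g); rewrite size_circulant.
case: (f g); last by move=> _ ->; rewrite [is_black _]/= !muln0 !addn0.
by move=> <- <-; rewrite [is_black _]/=; lia.
Qed.

Lemma balanced_nonzero (l : seq nat) (b c : nat) (f : int -> bool) :
  (0 < b)%N -> (0 < c)%N -> balanced l b c f -> has (fun d => 0 < d)%N l.
Proof.
move=> b_gt0 c_gt0 bal; apply: contraT => /hasPn l0.
have : (\sum_(d <- l) (f (0 + d%:Z)%R + f (0 - d%:Z)%R) = \sum_(d <- l) 2 * f 0%R)%N.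
  rewrite big_seq [RHS]big_seq; apply: eq_bigr => d /l0; rewrite -eqn0Ngt => /eqP ->.
  by rewrite !addr0 mul2n addnn.
rewrite big_const_seq count_predT iter_addn_0 => e.
by have := bal 0; rewrite e; case: (f 0) => /=; lia.
Qed.

Lemma circulant_reduction (k : nat) (l : k.-tuple nat) (b c : nat) :
  (0 < b)%N -> (0 < c)%N -> has_perfect_2colouring (circulant l) b c ->
  exists l' f N, [/\ size l' = k, balanced l' b c f,
    setwise_coprime l', (0 < N)%N &
    forall g, f (g + N%:Z) = f g].
Proof.
move=> b_gt0 c_gt0 /perfect_balanced[f bal].
have [l' [f' [sz bal' nz gcd1]]] :=
  balanced_gcd bal (balanced_nonzero b_gt0 c_gt0 bal).
have [N N_gt0 per] := balanced_periodic bal' nz.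
by exists l', f', N; rewrite sz size_tuple.
Qed.

(** * Shifts modulo a prime *)

(** The action of polynomials on sequences in which ['X] is the shift [g |-> g + 1]. *)
Definition shift_act (R : nzRingType) (P : {poly R}) (u : int -> R) (g : int) : R :=
  \sum_(i < size P) P`_i * u (g + (i : nat)%:Z).

Lemma shift_act_widen (R : nzRingType) (P : {poly R}) (u : int -> R) (n : nat) (g : int) :
  (size P <= n)%N -> shift_act P u g = \sum_(i < n) P`_i * u (g + (i : nat)%:Z).
Proof.
move=> le_n; rewrite /shift_act (big_ord_widen _ (fun i => P`_i * u (g + i%:Z)) le_n).
rewrite big_mkcond /=; apply: eq_bigr => i _; case: ltnP => // le_i.
by rewrite nth_default // mul0r.
Qed.

Lemma shift_actD (R : nzRingType) (P Q : {poly R}) (u : int -> R) (g : int) :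
  shift_act (P + Q) u g = shift_act P u g + shift_act Q u g.
Proof.
pose n := maxn (size P) (size Q).
rewrite !(@shift_act_widen _ _ _ n) ?leq_maxl ?leq_maxr ?size_polyD // -big_split.
by apply: eq_bigr => i _; rewrite coefD mulrDl.
Qed.

Lemma shift_actC (R : nzRingType) (a : R) (P : {poly R}) (u : int -> R) (g : int) :
  shift_act (a%:P * P) u g = a * shift_act P u g.
Proof.
rewrite (@shift_act_widen _ _ _ (size P)); last first.
  by rewrite mul_polyC size_scale_leq.
by rewrite mulr_sumr; apply: eq_bigr => i _; rewrite coefCM mulrA.
Qed.

Lemma shift_act_mulX (R : nzRingType) (P : {poly R}) (u : int -> R) (g : int) :
  shift_act (P * 'X) u g = shift_act P u (g + 1).
Proof.
rewrite (@shift_act_widen _ _ _ (size P).+1); last first.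
  by apply: leq_trans (size_polyMleq _ _) _; rewrite size_polyX addn2.
rewrite big_ord_recl coefMX mul0r add0r; apply: eq_bigr => i _.
by rewrite coefMX /=; congr (_ * u _); rewrite /bump; lia.
Qed.

Lemma shift_act0 (R : nzRingType) (u : int -> R) (g : int) : shift_act 0 u g = 0.
Proof. by rewrite /shift_act size_poly0 big_ord0. Qed.

Lemma shift_act1 (R : nzRingType) (u : int -> R) (g : int) : shift_act 1 u g = u g.
Proof. by rewrite /shift_act size_poly1 big_ord1 coef1 mul1r addr0. Qed.

Lemma shift_actXn (R : nzRingType) (n : nat) (u : int -> R) (g : int) :
  shift_act 'X^n u g = u (g + n%:Z).
Proof.
elim: n g => [|n IHn] g; first by rewrite shift_act1 addr0.
by rewrite exprSr shift_act_mulX IHn; congr u; lia.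
Qed.

Lemma shift_act_sum (R : nzRingType) (I : Type) (r : seq I) (F : I -> {poly R})
    (u : int -> R) (g : int) :
  shift_act (\sum_(i <- r) F i) u g = \sum_(i <- r) shift_act (F i) u g.
Proof.
elim: r => [|i r IHr]; first by rewrite !big_nil shift_act0.
by rewrite !big_cons shift_actD IHr.
Qed.

Lemma shift_act_comp (R : nzRingType) (P Q : {poly R}) (u : int -> R) (g : int) :
  shift_act (P * Q) u g = shift_act P (shift_act Q u) g.
Proof.
elim/poly_ind: P g => [|P a IHP] g; first by rewrite mul0r !shift_act0.
rewrite mulrDl -mulrA -commr_polyX mulrA !shift_actD !shift_act_mulX IHP shift_actC.
by congr (_ + _); rewrite -[a%:P]mulr1 shift_actC shift_act1.
Qed.

(** Modulo [p] the operator [A - 2 k] sends [f] to the constant [c], and it kills constants, so its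
    [p]-th power kills [f]. By Frobenius this power is [A_p - 2 k], with distances [p * d]. Since
    [2 k < p], the resulting congruence between numbers below [p] is an equality. *)
Lemma balanced_prime_shift (l : seq nat) (b c p : nat) (f : int -> bool) :
  prime p -> (p %| b + c)%N -> (2 * size l < p)%N -> balanced l b c f ->
  forall d g, d \in l -> f (g + (p * d)%N%:Z) = f g.
Proof.
move=> pp pbc lt_p bal d0 g0 d0l.
pose L := (\sum_(d <- l) d)%N.
have le_L d : d \in l -> (d <= L)%N by move=> dl; rewrite /L (big_rem d) //= leq_addr.
pose k2 := (2 * size l)%N.
pose u g : 'F_p := (f g)%:R.
(* [Q m] is [A_m - 2 k] times the shift by [m * L], which keeps all exponents nonnegative. *)
pose Q (m : nat) : {poly 'F_p} :=
  \sum_(d <- l) ('X^(m * (L + d)) + 'X^(m * (L - d))) - k2%:R%:P * 'X^(m * L).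
have actQ m g : shift_act (Q m) u (g - (m * L)%N%:Z) =
    (\sum_(d <- l) (f (g + (m * d)%N%:Z)%R + f (g - (m * d)%N%:Z)%R))%N%:R
    - (k2 * f g)%N%:R.
  rewrite /Q -mulNr -polyCN shift_actD shift_actC shift_actXn subrK.
  rewrite shift_act_sum natr_sum natrM mulNr; congr (_ - _).
  rewrite big_seq [RHS]big_seq; apply: eq_bigr => d /le_L le_dL.
  rewrite shift_actD !shift_actXn natrD; congr ((f _)%:R + (f _)%:R).
    by rewrite mulnDr; lia.
  by rewrite mulnBr; nia.
have pF : p \in [pchar 'F_p] by apply: pchar_Fp.
have bc0 : (b + c)%:R = 0 :> 'F_p.
  by apply/eqP; rewrite -(dvdn_pcharf pF).
have act1 g : shift_act (Q 1%N) u g = c%:R.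
  rewrite -[g](addrK (1 * L)%N%:Z) actQ.
  have /(congr1 (fun n => n%:R : 'F_p)) := bal (g + (1 * L)%N%:Z).
  rewrite natrD natrM bc0 mul0r addr0 [in RHS]natrD => e.
  apply/eqP; rewrite subr_eq -e; apply/eqP.
  by congr (1 *+ _); apply: eq_bigr => d _; rewrite !mul1n.
have Q1 : (Q 1%N).[1] = 0.
  rewrite /Q hornerD hornerN hornerM hornerC hornerXn expr1n mulr1 horner_sum.
  under eq_bigr do rewrite hornerD !hornerXn !expr1n -[1 + 1]/(2%:R).
  by rewrite big_const_seq count_predT iter_addr_0 -mulrnA subrr.
have act_cst (P : {poly 'F_p}) (a : 'F_p) g : shift_act P (fun=> a) g = P.[1] * a.
  rewrite horner_coef mulr_suml; apply: eq_bigr => i _.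
  by rewrite expr1n mulr1.
have shift_act_ext (P : {poly 'F_p}) (u1 u2 : int -> 'F_p) g :
    u1 =1 u2 -> shift_act P u1 g = shift_act P u2 g.
  by move=> e; apply: eq_bigr => i _; rewrite e.
have actn n g : (1 < n)%N -> shift_act (Q 1%N ^+ n) u g = 0.
  case: n => [|[|n]] // _; rewrite exprSr shift_act_comp.
  rewrite (shift_act_ext _ _ (fun=> c%:R)) // act_cst.
  by rewrite exprS hornerM Q1 !mul0r.
have Qp : Q 1%N ^+ p = Q p.
  have pP : p \in [pchar {poly 'F_p}] by rewrite pchar_poly.
  rewrite -(pFrobenius_autE pP) rmorphB rmorph_sum rmorphM /=; congr (_ - _ * _).
  - apply: eq_bigr => d _; rewrite rmorphD /= !pFrobenius_autE -!exprM.
    by rewrite !mul1n ![(_ * p)%N]mulnC.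
  - by rewrite polyC_natr pFrobenius_aut_nat.
  - by rewrite pFrobenius_autE -exprM mul1n mulnC.
have le2 (s : seq nat) (F G : nat -> bool) :
    (\sum_(d <- s) (F d + G d) <= 2 * size s)%N.
  elim: s => [|d s IHs]; first by rewrite big_nil.
  by rewrite big_cons mulnS leq_add //; case: (F d) (G d) => [] [].
have main g :
    (\sum_(d <- l) (f (g + (p * d)%N%:Z)%R + f (g - (p * d)%N%:Z)%R) = k2 * f g)%N.
  have /eqP := actn p (g - (p * L)%N%:Z) (prime_gt1 pp).
  rewrite Qp actQ subr_eq0 => /eqP e.
  have leS : (\sum_(d <- l) (f (g + (p * d)%N%:Z)%R + f (g - (p * d)%N%:Z)%R) < p)%N.
    exact: leq_ltn_trans (le2 _ _ _) lt_p.
  have lek : (k2 * f g < p)%N.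
    by apply: leq_ltn_trans lt_p; rewrite /k2; case: (f g); rewrite ?muln1 ?muln0.
  move/(congr1 val): e; rewrite /= !val_Fp_nat //.
  by rewrite !modn_small.
(* The [2 k] values add up to [0] or to [2 k], so each of them equals [f g0]. *)
move: (main g0); rewrite (big_rem d0) //=.
have : (\sum_(d <- rem d0 l)
    (f (g0 + (p * d)%N%:Z)%R + f (g0 - (p * d)%N%:Z)%R) <= 2 * (size l).-1)%N.
  by rewrite -(size_rem d0l) le2.
have : (0 < size l)%N by case: (l) d0l.
rewrite /k2; case: (f g0); case: (f (g0 + _)) => //; case: (f (g0 - _)) => /=; lia.
Qed.

(* The order of [z] has [p]-adic valuation [s.+1] (for [M] prime to [p]). *)
Definition at_level (p M s : nat) (z : algC) : Prop :=
  z ^+ (M * p ^ s.+1) = 1 /\ z ^+ (M * p ^ s) != 1.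

(** If [o] is the order of [z], then [o %/ gcdn o m] divides every distance, so it is [1]. *)
Lemma setwise_coprime_exp (R : nzRingType) (l : seq nat) (n m : nat) (z : R) :
  setwise_coprime l -> (0 < n)%N -> z ^+ n = 1 ->
  (forall d, d \in l -> z ^+ (d * m) = 1) -> z ^+ m = 1.
Proof.
move=> cl n_gt0 zn zl; have [o prim_z on] := prim_order_exists n_gt0 zn.
have o_gt0 := prim_order_gt0 prim_z.
have g_gt0 : (0 < gcdn o m)%N by rewrite gcdn_gt0 o_gt0.
have : (o %/ gcdn o m = 1)%N.
  apply: cl; apply/allP => d dl.
  have odm : (o %| d * m)%N by rewrite (prim_order_dvd prim_z) zl.
  rewrite -(@dvdn_pmul2r (gcdn o m)) // divnK ?dvdn_gcdl //.
  by rewrite muln_gcdr dvdn_gcd odm dvdn_mull.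
move=> /(congr1 (muln^~ (gcdn o m))); rewrite divnK ?dvdn_gcdl // mul1n => eo.
by apply/eqP; rewrite -(prim_order_dvd prim_z) eo dvdn_gcdr.
Qed.

(** The [n] for which [p * n] is a period are closed under multiples and gcd. *)
Lemma setwise_coprime_period (l : seq nat) (p : nat) (f : int -> bool) :
  setwise_coprime l -> (forall d g, d \in l -> f (g + (p * d)%N%:Z) = f g) ->
  forall g, f (g + p%:Z) = f g.
Proof.
move=> cl fl; pose S n := forall g, f (g + (p * n)%N%:Z) = f g.
have Smul n m : S n -> S (m * n)%N.
  move=> Sn; elim: m => [|m IHm] g; first by rewrite mul0n muln0 addr0.
  by rewrite mulSn mulnDr PoszD addrA IHm Sn.
have Sgcd x y : S x -> S y -> S (gcdn x y).
  move=> Sx Sy; have [->|x_gt0] := posnP x; first by rewrite gcd0n.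
  have [u v e _] := egcdnP y x_gt0 => g.
  rewrite -(Smul _ v Sy) -[in RHS](Smul _ u Sx) e mulnDr PoszD; congr f.
  by rewrite addrAC addrA.
have S1 : S 1%N.
  rewrite -[1%N](cl (\big[gcdn/0%N]_(d <- l) d)); last first.
    by apply/allP => d dl; rewrite (big_rem d) //= dvdn_gcdl.
  rewrite big_seq; elim/big_ind: _ => //; first by move=> g; rewrite muln0 addr0.
  by move=> d dl g; apply: fl.
by move=> g; have := S1 g; rewrite muln1.
Qed.

Lemma at_level_exp (l : seq nat) (p M s : nat) (z : algC) :
  (0 < M * p ^ s.+1)%N -> setwise_coprime l -> at_level p M s z ->
  exists2 d, d \in l & at_level p M s (z ^+ d).
Proof.
move=> n_gt0 cl [z1 z0].
have [/hasP[d dl zd]|/hasPn hl] := boolP (has (fun d => z ^+ d ^+ (M * p ^ s) != 1) l).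
  by exists d => //; split=> //; rewrite exprAC z1 expr1n.
case/eqP: z0; apply: (setwise_coprime_exp cl n_gt0 z1) => d dl.
by apply/eqP; rewrite [_ ^+ _]exprM; have := hl d dl; rewrite negbK.
Qed.

(** With period [p], each [z ^+ d] has mean [1] or [- 1 / (p - 1)], so twice the sum of the means is
    at least [- 2 k / (p - 1) > -1]. The eigenvalue [2 k - p] is at most [-2], so the Fourier
    support is trivial. *)
Lemma no_perfect_prime (p k b c : nat) :
  prime p -> (b + c = p)%N -> (0 < b)%N -> (0 < c)%N -> (2 * k < p.-1)%N ->
  ~ exists l : k.-tuple nat, has_perfect_2colouring (circulant l) b c.
Proof.
move=> pp ebc b_gt0 c_gt0 lt_kp [l0 /(circulant_reduction b_gt0 c_gt0)].
move=> [l [f [_ [szl bal cl _ _]]]]; have p_gt0 := prime_gt0 pp.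
have pbc : (p %| b + c)%N by rewrite ebc.
have lt_k : (2 * size l < p)%N by rewrite szl; apply: leq_trans lt_kp (leq_pred _).
have per := setwise_coprime_period cl (balanced_prime_shift pp pbc lt_k bal).
have ep : p = (p ^ 1 * 1)%N by rewrite expn1 muln1.
have cpc : coprime p c.
  by rewrite prime_coprime // gtnNdvd // -ebc -addn1 addnC leq_add2r.
have := level_bound (E := [::]) pp ep isT (coprimen1 p) cpc per bal.
rewrite expn1 ebc dvdnn => /(_ _) h; suff : ~~ true by [].
apply: h => s z; rewrite ltnS leqn0 => /eqP -> _.
rewrite !mul1n expn0 expn1 expr1 => zp z_neq1.
apply/eqP => ez; have {}ez : eigsum l z = ((2 * k)%:Z - p%:Z)%:~R.
  by rewrite ez szl rmorphB.
have := galois_mean_sum p_gt0 zp ez.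
have mean_ge d : -1 <= galois_mean p (z ^+ d) * (p%:R - 1).
  have zdp : z ^+ d ^+ p = 1 by rewrite exprAC zp expr1n.
  have p1 : (0 : rat) <= p%:R - 1 by rewrite subr_ge0 ler1n.
  have [->|zd1] := eqVneq (z ^+ d) 1; first by rewrite galois_mean1 // mul1r; lra.
  have := @galois_mean_level p p 1 1 0 (z ^+ d) pp (coprimen1 p) ep p_gt0 zdp.
  rewrite !mul1n expn1 expn0 expr1 => /(_ zdp zd1).
  have := ler_norm (- galois_mean p (z ^+ d)); rewrite normrN.
  by move=> /(ler_wpM2r p1); lra.
have : - k%:R <= \sum_(d <- l) galois_mean p (z ^+ d) * (p%:R - 1).
  apply: le_trans (ler_sum _ (fun d _ => mean_ge d)).
  by rewrite big_const_seq count_predT szl iter_addr_0 mulNrn.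
rewrite -mulr_suml rmorphB /= -!pmulrn => h1 h2.
have k2p : (2 * k)%:R + 2%:R <= p%:R :> rat by rewrite -natrD ler_nat; lia.
move: k2p h1 h2; rewrite natrM; set S := \sum_(_ <- _) _; set x := p%:R; set y := k%:R.
have y_ge0 : 0 <= y by rewrite ler0n.
by nra.
Qed.

(** * Odd primes dividing the denominator of the density *)

(** Here [- m] is the eigenvalue [2 k - (b + c)]. The list [E] of conceded levels may depend on the
    distances, but must be shorter than the exponent of [p] in [b + c]. *)
Lemma no_perfect_levels (p k b c m : nat) :
  prime p -> coprime p c -> (0 < b)%N -> (0 < c)%N -> (b + c = 2 * k + m)%N ->
  (forall l N a M, size l = k -> setwise_coprime l -> (0 < N)%N ->
     N = (p ^ a * M)%N -> coprime p M ->
     exists2 E : seq nat, (p ^ (size E).+1 %| b + c)%N &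
     forall s z, (s < a)%N -> s \notin E -> at_level p M s z ->
     eigsum l z <> - m%:R) ->
  ~ exists l : k.-tuple nat, has_perfect_2colouring (circulant l) b c.
Proof.
move=> pp cpc b_gt0 c_gt0 ebc hE [l0 /(circulant_reduction b_gt0 c_gt0)].
move=> [l [f [N [szl bal cl N_gt0 per]]]].
have [a [M [eN cpM]]] := prime_decomp_coprime pp N_gt0.
have M_gt0 : (0 < M)%N by move: N_gt0; rewrite eN muln_gt0 => /andP[].
have [E pE hz] := hE l N a M szl cl N_gt0 eN cpM.
have := level_bound (E := E) pp eN M_gt0 cpM cpc per bal.
rewrite pE => h; suff : ~~ true by [].
apply: h => s z lt_sa sE z1 z0; apply/eqP => ez.
apply: (hz s z lt_sa sE (conj z1 z0)).
by rewrite ez szl ebc natrD opprD addrA subrr add0r.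
Qed.

Lemma at_level_unity (p M s a N : nat) (z : algC) :
  N = (p ^ a * M)%N -> (s < a)%N -> at_level p M s z -> z ^+ N = 1.
Proof.
move=> eN lt_sa [z1 _]; apply: dvd_exp1 z1.
by rewrite eN mulnC dvdn_mul // dvdn_exp2l.
Qed.

Lemma at_level_coprime (p M s m : nat) (z : algC) :
  coprime p m -> z ^+ m = 1 -> ~ at_level p M s z.
Proof.
move=> cpm zm [z1 /eqP z0]; apply: z0.
apply: dvd_exp1 (exp_mod_gcd zm z1).
rewrite expnS mulnA mulnAC Gauss_gcdl ?dvdn_gcdr // coprime_sym.
by [].
Qed.

Lemma mean_sum (N : nat) (l : seq nat) (z : algC) (m : nat) :
  (0 < N)%N -> z ^+ N = 1 -> eigsum l z = - m%:R ->
  2 * \sum_(d <- l) galois_mean N (z ^+ d) = - m%:R.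
Proof.
move=> N_gt0 zN ez; have := @galois_mean_sum N l z (- m%:Z) N_gt0 zN.
by rewrite ez !rmorphN /= -!pmulrn; apply.
Qed.

Lemma root_cases (N : nat) (y : algC) :
  (0 < N)%N -> y ^+ N = 1 ->
  [\/ [/\ y = -1, galois_mean N y = -1 & y + y^-1 = -2],
      [/\ y ^+ 2 + y + 1 = 0, galois_mean N y = - 2^-1 & y + y^-1 = -1]
    | - 4^-1 <= galois_mean N y].
Proof.
move=> N_gt0 yN; have [[ey em]|[ey em]|h] := galois_mean_cases N_gt0 yN.
- by constructor 1; split; rewrite // ey invrN invr1; ring.
- constructor 2; split=> //.
  apply: trace_neq0; first exact: root_of_unity_neq0 yN.
  by rewrite mulN1r opprK.
by constructor 3.
Qed.

Lemma trace0_sqr (y : algC) : y != 0 -> y + y^-1 = 0 -> y ^+ 2 = -1.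
Proof.
move=> ny e; apply/eqP; rewrite -addr_eq0; apply/eqP.
by rewrite -[1](mulfV ny) expr2 -mulrDr e mulr0.
Qed.

Lemma trace0_exp4 (y : algC) : y != 0 -> y + y^-1 = 0 -> y ^+ 4 = 1.
Proof. by move=> ny /(trace0_sqr ny) e; rewrite (exprM y 2 2) e sqrrN expr1n. Qed.

(** Setwise coprimality keeps some [z ^+ d] at the level of [z], hence with mean at least
    [- 1 / (p - 1)]; this [d] is brought to the front. *)
Lemma at_level_perm (l : seq nat) (N p a M s : nat) (z : algC) :
  prime p -> coprime p M -> (0 < N)%N -> N = (p ^ a * M)%N -> (s < a)%N ->
  setwise_coprime l -> at_level p M s z ->
  exists d r, [/\ perm_eq l (d :: r), size r = (size l).-1, at_level p M s (z ^+ d)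
    & - galois_mean N (z ^+ d) * (p%:R - 1) <= 1].
Proof.
move=> pp cpM N_gt0 eN lt_sa cl zs; have zN := at_level_unity eN lt_sa zs.
have n_gt0 : (0 < M * p ^ s.+1)%N.
  by move: N_gt0; rewrite eN !muln_gt0 !expn_gt0 prime_gt0 // => /andP[_ ->].
have [d dl zds] := at_level_exp n_gt0 cl zs.
exists d, (rem d l); split=> //; first exact: perm_to_rem.
  by rewrite size_rem.
have zdN : z ^+ d ^+ N = 1 by rewrite exprAC zN expr1n.
have [zd1 zd0] := zds.
apply: le_trans (galois_mean_level pp cpM eN N_gt0 zdN zd1 zd0).
rewrite ler_wpM2r //; last by rewrite -normrN ler_norm.
by rewrite subr_ge0 ler1n prime_gt0.
Qed.

Lemma eigsum_perm (l l' : seq nat) (z : algC) :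
  perm_eq l l' -> eigsum l z = eigsum l' z.
Proof. exact: perm_big. Qed.

(** The means add up to [-2] and that of [z ^+ d0] is at least [-1/4], so the other two are [-1].
    Then [z ^+ d0] has trace term [0], so its fourth power is [1], although [5] divides its
    order. *)
Lemma no_perfect_3_6_4 :
  ~ exists l : 3.-tuple nat, has_perfect_2colouring (circulant l) 6 4.
Proof.
apply: (@no_perfect_levels 5 3 6 4 4) => // l N a M szl cl N_gt0 eN cpM.
exists [::] => // s z lt_sa _ zs ez; have zN := at_level_unity eN lt_sa zs.
have [d0 [r [pl szr zd0 m0]]] := at_level_perm (isT : prime 5) cpM N_gt0 eN lt_sa cl zs.
rewrite (eigsum_perm _ pl) in ez.
case: r szr pl ez => [|d1 [|d2 [|? ?]]] szr pl ez; rewrite szl // in szr.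
have zdN d : z ^+ d ^+ N = 1 by rewrite exprAC zN expr1n.
have := mean_sum N_gt0 zN ez; rewrite !big_cons big_nil.
move: ez; rewrite /eigsum !big_cons big_nil.
have [[_ m1 x1]|[_ m1 x1]|m1] := root_cases N_gt0 (zdN d1);
  have [[_ m2 x2]|[_ m2 x2]|m2] := root_cases N_gt0 (zdN d2); try by move=> _; lra.
rewrite x1 x2 => ez _; apply: (@at_level_coprime 5 M s 4 (z ^+ d0)) => //.
apply: trace0_exp4; first exact: root_of_unity_neq0 (zdN d0).
by apply: (addIr (-4%:R)); rewrite -[X in _ = _ + X]ez; ring.
Qed.

(** The means add up to [-3] and that of [z ^+ d0] is at least [-1/6], so the other three are [-1]
    and [z ^+ d0] is a fourth root of unity, although [7] divides its order. *)
Lemma no_perfect_4_8_6 :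
  ~ exists l : 4.-tuple nat, has_perfect_2colouring (circulant l) 8 6.
Proof.
apply: (@no_perfect_levels 7 4 8 6 6) => // l N a M szl cl N_gt0 eN cpM.
exists [::] => // s z lt_sa _ zs ez; have zN := at_level_unity eN lt_sa zs.
have [d0 [r [pl szr zd0 m0]]] := at_level_perm (isT : prime 7) cpM N_gt0 eN lt_sa cl zs.
rewrite (eigsum_perm _ pl) in ez.
case: r szr pl ez => [|d1 [|d2 [|d3 [|? ?]]]] szr pl ez; rewrite szl // in szr.
have zdN d : z ^+ d ^+ N = 1 by rewrite exprAC zN expr1n.
have := mean_sum N_gt0 zN ez; rewrite !big_cons big_nil.
move: ez; rewrite /eigsum !big_cons big_nil.
have [[_ m1 x1]|[_ m1 x1]|m1] := root_cases N_gt0 (zdN d1);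
  have [[_ m2 x2]|[_ m2 x2]|m2] := root_cases N_gt0 (zdN d2);
  have [[_ m3 x3]|[_ m3 x3]|m3] := root_cases N_gt0 (zdN d3); try by move=> _; lra.
rewrite x1 x2 x3 => ez _; apply: (@at_level_coprime 7 M s 4 (z ^+ d0)) => //.
apply: trace0_exp4; first exact: root_of_unity_neq0 (zdN d0).
by apply: (addIr (-6%:R)); rewrite -[X in _ = _ + X]ez; ring.
Qed.

(** The means would add up to [-7/2], but they add up to at least [-1/4 - 3]. *)
Lemma no_perfect_4_8_7 :
  ~ exists l : 4.-tuple nat, has_perfect_2colouring (circulant l) 8 7.
Proof.
apply: (@no_perfect_levels 5 4 8 7 7) => // l N a M szl cl N_gt0 eN cpM.
exists [::] => // s z lt_sa _ zs ez; have zN := at_level_unity eN lt_sa zs.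
have [d0 [r [pl szr zd0 m0]]] := at_level_perm (isT : prime 5) cpM N_gt0 eN lt_sa cl zs.
rewrite (eigsum_perm _ pl) in ez.
case: r szr pl ez => [|d1 [|d2 [|d3 [|? ?]]]] szr pl ez; rewrite szl // in szr.
have mean_ge d : -1 <= galois_mean N (z ^+ d).
  have zdN : z ^+ d ^+ N = 1 by rewrite exprAC zN expr1n.
  have := galois_mean_bound N_gt0 zdN.
  by have := ler_norm (- galois_mean N (z ^+ d)); rewrite normrN; lra.
have := mean_sum N_gt0 zN ez; rewrite !big_cons big_nil.
by move: (mean_ge d1) (mean_ge d2) (mean_ge d3); lra.
Qed.

(** As [b + c = 3 ^ 2], level [0] may be conceded. At higher levels [z ^+ d0] has mean [0], so the
    other means, adding up to [-3/2], are [-1] and [-1/2]. Then [z ^+ d0] is a fourth root of unity,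
    although [3] divides its order. *)
Lemma no_perfect_3_5_4 :
  ~ exists l : 3.-tuple nat, has_perfect_2colouring (circulant l) 5 4.
Proof.
apply: (@no_perfect_levels 3 3 5 4 3) => // l N a M szl cl N_gt0 eN cpM.
exists [:: 0%N] => // -[//|s] z lt_sa _ zs ez; have zN := at_level_unity eN lt_sa zs.
have [d0 [r [pl szr zd0 _]]] := at_level_perm (isT : prime 3) cpM N_gt0 eN lt_sa cl zs.
rewrite (eigsum_perm _ pl) in ez.
case: r szr pl ez => [|d1 [|d2 [|? ?]]] szr pl ez; rewrite szl // in szr.
have zdN d : z ^+ d ^+ N = 1 by rewrite exprAC zN expr1n.
have [zd1 zd2] := zd0; have m0 := galois_mean_high eN N_gt0 (zdN d0) zd1 zd2.
have := mean_sum N_gt0 zN ez; rewrite !big_cons big_nil m0.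
move: ez; rewrite /eigsum !big_cons big_nil => ez e.
have x0 : z ^+ d0 + z ^- d0 != 0.
  apply/eqP => e0; apply: (@at_level_coprime 3 M s.+1 4 (z ^+ d0)) => //.
  by apply: trace0_exp4; first exact: root_of_unity_neq0 (zdN d0).
move: ez e.
have [[_ m1 x1]|[_ m1 x1]|m1] := root_cases N_gt0 (zdN d1);
  have [[_ m2 x2]|[_ m2 x2]|m2] := root_cases N_gt0 (zdN d2); try by move=> _; lra.
  rewrite x1 x2 => ez _; case/eqP: x0.
  by apply: (addIr (-3%:R)); rewrite -[X in _ = _ + X]ez; ring.
rewrite x1 x2 => ez _; case/eqP: x0.
by apply: (addIr (-3%:R)); rewrite -[X in _ = _ + X]ez; ring.
Qed.

(** * The prime 2 *)

Lemma at_level2N1 (M s : nat) (z : algC) :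
  at_level 2 M s z -> z ^+ (M * 2 ^ s) = -1.
Proof.
move=> [z1 z0]; have /eqP : (z ^+ (M * 2 ^ s)) ^+ 2 = 1.
  by rewrite -exprM -mulnA -expnSr.
by rewrite sqrf_eq1 (negPf z0) => /eqP.
Qed.

Lemma exprN1_odd (n : nat) : odd n -> (-1 : algC) ^+ n = -1.
Proof. by rewrite -signr_odd => ->. Qed.

Lemma algC_N1_neq1 : (-1 : algC) <> 1.
Proof. by move/eqP; rewrite -subr_eq0 -opprD oppr_eq0 -[1 + 1]/(2%:R) pnatr_eq0. Qed.

(** The order of [z] divides [2 m] but not [m], so its [2]-adic valuation is [(logn 2 m).+1]. *)
Lemma at_level2_logn (M s m : nat) (z : algC) :
  odd M -> at_level 2 M s z -> z ^+ m = -1 -> s = logn 2 m.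
Proof.
move=> oM zs zm; have zN1 := at_level2N1 zs; have [z1 _] := zs.
have m_gt0 : (0 < m)%N.
  by rewrite lt0n; apply/eqP => m0; apply: algC_N1_neq1; rewrite -zm m0.
have [m' co2m' em] := pfactor_coprime (isT : prime 2) m_gt0.
set v := logn 2 m in em *; rewrite coprime2n in co2m'.
case: (ltngtP s v) => // lt_sv; case: algC_N1_neq1.
  rewrite -{1}(exprN1_odd oM) -zm -exprM em; apply: dvd_exp1 z1.
  by rewrite [(_ * M)%N]mulnC dvdn_mul // dvdn_mull // dvdn_exp2l.
rewrite -{1}(exprN1_odd co2m') -zN1 -exprM.
have -> : (M * 2 ^ s * m' = m * (M * 2 ^ (s - v)))%N.
  by rewrite -{1}(subnK (ltnW lt_sv)) expnD em; lia.
by rewrite exprM zm -signr_odd oddM oddX subn_eq0 leqNgt lt_sv andbF.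
Qed.

Lemma eigsum_cons (d : nat) (l : seq nat) (z : algC) :
  eigsum (d :: l) z = z ^+ d + z ^- d + eigsum l z.
Proof. exact: big_cons. Qed.

Lemma eigsum_nil (z : algC) : eigsum [::] z = 0.
Proof. exact: big_nil. Qed.

Lemma perm_parity (l : seq nat) :
  perm_eq l ([seq d <- l | ~~ odd d] ++ [seq d <- l | odd d]).
Proof. by rewrite perm_sym perm_catC (perm_filterC odd). Qed.

Lemma eigsum_cat (l1 l2 : seq nat) (z : algC) :
  eigsum (l1 ++ l2) z = eigsum l1 z + eigsum l2 z.
Proof. exact: big_cat. Qed.

(* The Galois conjugation [z |-> z ^+ (1 + M * 2 ^ s)] fixes [z ^+ d] for even
   [d] and negates it for odd [d]. *)
Lemma eigsum_parity (l : seq nat) (N a M s m : nat) (z : algC) :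
  N = (2 ^ a * M)%N -> odd M -> (s.+1 < a)%N -> at_level 2 M s.+1 z ->
  eigsum l z = - m%:R ->
  eigsum [seq d <- l | ~~ odd d] z = - m%:R /\ eigsum [seq d <- l | odd d] z = 0.
Proof.
move=> eN oM lt_sa zs ez; have zN := at_level_unity eN lt_sa zs.
set h := (M * 2 ^ s.+1)%N.
have cop : coprime (1 + h) N.
  (* As the level [s.+1] is positive, [h] is even, so [1 + h] is a unit modulo [N]. *)
  have c1 : coprime (1 + h) h by rewrite addnC coprime_sym /coprime gcdnDl gcdn1.
  rewrite eN coprimeMr coprimeXr; last first.
    by rewrite coprimen2 oddD /h oddM oddX andbF.
  by apply: coprime_dvdr c1; rewrite /h dvdn_mulr.
have := @eigsum_galois N (1 + h) l z (- m%:Z) cop zN.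
rewrite rmorphN /= -pmulrn => /(_ ez).
have zt : z ^+ (1 + h) = - z by rewrite exprD expr1 at_level2N1 // mulrN1.
rewrite zt; move: ez; rewrite !(eigsum_perm _ (perm_parity l)) !eigsum_cat.
have -> : eigsum [seq d <- l | ~~ odd d] (- z) = eigsum [seq d <- l | ~~ odd d] z.
  rewrite /eigsum !big_filter; apply: eq_bigr => d /negPf od.
  by rewrite exprNn -signr_odd od mul1r.
have -> : eigsum [seq d <- l | odd d] (- z) = - eigsum [seq d <- l | odd d] z.
  rewrite /eigsum !big_filter -sumrN; apply: eq_bigr => d od.
  by rewrite exprNn -signr_odd od mulN1r invrN opprD.
set x := eigsum _ z; set y := eigsum _ z => e1 e2.
have y0 : y = 0.
  have /eqP : 2 * y = (x + y) - (x - y) by ring.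
  by rewrite e1 e2 subrr mulf_eq0 pnatr_eq0 => /eqP.
by rewrite -e1 y0 addr0.
Qed.

Lemma traceN2 (y : algC) : y != 0 -> y + y^-1 = -2 -> y = -1.
Proof.
move=> ny e; apply/eqP; rewrite -addr_eq0 -[_ == 0]andTb -(expf_eq0 _ 2).
have -> : (y + 1) ^+ 2 = y * (y + y^-1 + 2) by rewrite !mulrDr mulfV //; ring.
by rewrite e addNr mulr0.
Qed.

(** The hypothesis gives [z ^+ (o * 2) = -1], and [o * 2] has [2]-adic valuation [1]. *)
Lemma at_level2_trace0 (M s o : nat) (z : algC) :
  odd M -> odd o -> at_level 2 M s z -> z ^+ o != 0 -> z ^+ o + z ^- o = 0 -> s = 1%N.
Proof.
move=> oM oo zs nz /(trace0_sqr nz); rewrite -exprM => zo.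
by rewrite (at_level2_logn oM zs zo) logn_Gauss ?coprime2n.
Qed.

Lemma setwise_coprime_odd (l : seq nat) :
  setwise_coprime l -> (0 < size [seq d <- l | odd d])%N.
Proof.
move=> cl; rewrite size_filter -has_count; apply: contraT => /hasPn hl.
suff : 2%N = 1%N by [].
by apply: cl; apply/allP => d /hl; rewrite dvdn2.
Qed.

Lemma no_perfect_3_5_3 :
  ~ exists l : 3.-tuple nat, has_perfect_2colouring (circulant l) 5 3.
Proof.
apply: (@no_perfect_levels 2 3 5 3 2) => // l N a M szl cl N_gt0 eN.
rewrite coprime2n => oM.
pose ev := [seq d <- l | ~~ odd d]; pose od := [seq d <- l | odd d].
have szeo : (size ev + size od = 3)%N by rewrite -size_cat -(perm_size (perm_parity l)).
(* As [b + c = 2 ^ 3], two levels may be conceded. At a positive level the even part is [-2] and the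
   odd part [0]: a single even [e] forces [z ^+ e = -1], and a single odd distance forces level
   [1]. *)
exists [:: 0%N; if ev is [:: e] then logn 2 e else 1%N] => // -[//|s] z lt_sa.
rewrite !inE negb_or /= => sE zs ez.
have zN := at_level_unity eN lt_sa zs.
have zdN d : z ^+ d != 0 by rewrite expf_neq0 // (root_of_unity_neq0 N_gt0 zN).
have [] := eigsum_parity eN oM lt_sa zs ez.
rewrite -/ev -/od; case eev : ev szeo sE => [|e1 [|e2 [|e3 ev']]] /= szeo sE.
- by rewrite eigsum_nil => /esym/eqP; rewrite oppr_eq0 pnatr_eq0.
- rewrite eigsum_cons eigsum_nil addr0 => /(traceN2 (zdN _)) ze.
  by rewrite (at_level2_logn oM zs ze) eqxx in sE.
- case eod : od szeo => [|o [|? ?]] // _ _.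
  have : o \in od by rewrite eod mem_head.
  rewrite mem_filter => /andP[oo _].
  rewrite eigsum_cons eigsum_nil addr0 => /(at_level2_trace0 oM oo zs (zdN _)) es.
  by rewrite es in sE.
have := setwise_coprime_odd cl; rewrite -/od; lia.
Qed.

(** * Four distances with parameters (7, 5) *)

Lemma galois_meanN (N : nat) (y : algC) :
  (0 < N)%N -> ~~ odd N -> y ^+ N = 1 -> galois_mean N (- y) = - galois_mean N y.
Proof.
move=> N_gt0 eN yN; have nyN : (- y) ^+ N = 1.
  by rewrite exprNn yN -signr_odd (negPf eN) mulr1.
apply: (fmorph_inj (@ratr algC)) => /=.
rewrite rmorphN /= !galois_meanE // -mulNr; congr (_ / _).
rewrite /unit_trace -sumrN; apply: eq_bigr => t ct.
have ot : odd t.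
  by rewrite -coprime2n coprime_sym; apply: coprime_dvdr ct; rewrite dvdn2.
by rewrite exprNn -signr_odd ot mulN1r.
Qed.

Lemma odd_order_trace_neq0 (M : nat) (y : algC) :
  odd M -> y ^+ M = 1 -> y + y^-1 <> 0.
Proof.
move=> oM yM e; have M_gt0 := odd_gt0 oM.
have y4 := trace0_exp4 (root_of_unity_neq0 M_gt0 yM) e.
have := exp_mod_gcd y4 yM.
have -> : gcdn 4 M = 1%N.
  by apply/eqP; rewrite -[_ == _]/(coprime (2 ^ 2) M) coprime_pexpl // coprime2n.
rewrite expr1 => y1; move/eqP: e; rewrite y1 invr1 -[1 + 1]/(2%:R).
by rewrite pnatr_eq0.
Qed.

(** The sum is [(y1 + y2) * (y1 * y2 + 1) / (y1 * y2)], and [-1] is neither a quotient nor a product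
    of roots of unity of odd order. *)
Lemma odd_order_trace2_neq0 (M : nat) (y1 y2 : algC) :
  odd M -> y1 ^+ M = 1 -> y2 ^+ M = 1 -> y1 + y1^-1 + (y2 + y2^-1) <> 0.
Proof.
move=> oM y1M y2M e; have M_gt0 := odd_gt0 oM.
have n1 := root_of_unity_neq0 M_gt0 y1M; have n2 := root_of_unity_neq0 M_gt0 y2M.
have /eqP : (y1 + y2) * (y1 * y2 + 1) = y1 * y2 * (y1 + y1^-1 + (y2 + y2^-1)).
  by field; rewrite n1 n2.
rewrite e mulr0 mulf_eq0 !addr_eq0 => /orP[]/eqP e1; apply: algC_N1_neq1.
  by rewrite -{2}y1M e1 exprNn y2M mulr1 exprN1_odd.
by rewrite -(exprN1_odd oM) -e1 exprMn y1M y2M mulr1.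
Qed.

Lemma odd_order_cases (N M : nat) (y : algC) :
  (0 < N)%N -> y ^+ N = 1 -> odd M -> y ^+ M = 1 ->
  [\/ [/\ y ^+ 2 + y + 1 = 0, galois_mean N y = - 2^-1 & y + y^-1 = -1],
      y ^+ 5 = 1 /\ galois_mean N y = - 4^-1
    | - 6^-1 <= galois_mean N y].
Proof.
move=> N_gt0 yN oM yM.
have [[_ m]|[e m]|[e m]|m] := galois_mean_odd_cases N_gt0 yN oM yM.
- by constructor 3; rewrite m; lra.
- constructor 1; split=> //; apply: trace_neq0; first exact: root_of_unity_neq0 yN.
  by rewrite mulN1r opprK.
- by constructor 2.
by constructor 3; have := ler_norm (- galois_mean N y); rewrite normrN; lra.
Qed.

(** The mean of [y] is minus that of [- y], which has odd order and hence mean at most [1/6] unless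
    it is [1]. *)
Lemma twice_odd_order_cases (N M : nat) (y : algC) :
  (0 < N)%N -> ~~ odd N -> y ^+ N = 1 -> odd M -> (- y) ^+ M = 1 ->
  [/\ y = -1, galois_mean N y = -1 & y + y^-1 = -2] \/ - 6^-1 <= galois_mean N y.
Proof.
move=> N_gt0 evN yN oM yM.
have yN' : (- y) ^+ N = 1 by rewrite exprNn yN -signr_odd (negPf evN) mulr1.
have em : galois_mean N y = - galois_mean N (- y).
  by rewrite galois_meanN // opprK.
have [[e m]|[_ m]|[_ m]|m] := galois_mean_odd_cases N_gt0 yN' oM yM.
- left; have ey : y = -1 by rewrite -e opprK.
  by split; rewrite // ?em ?m // ey invrN invr1; ring.
- by right; rewrite em m; lra.
- by right; rewrite em m; lra.
by right; rewrite em; have := ler_norm (galois_mean N (- y)); lra.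
Qed.

Lemma at_level2_0_even (M d : nat) (z : algC) :
  at_level 2 M 0 z -> ~~ odd d -> (z ^+ d) ^+ M = 1.
Proof.
move=> /at_level2N1; rewrite expn0 muln1 => zM ed.
by rewrite exprAC zM -signr_odd (negPf ed).
Qed.

Lemma at_level2_0_odd (M d : nat) (z : algC) :
  odd M -> at_level 2 M 0 z -> odd d -> (- z ^+ d) ^+ M = 1.
Proof.
move=> oM /at_level2N1; rewrite expn0 muln1 => zM od.
by rewrite exprNn exprAC zM -!(signr_odd _ d) -signr_odd oM od mulrNN mulr1.
Qed.

(** Even powers of [z] have odd order and odd powers are minus such roots. The means add up to [-2]:
    if both odd powers are [-1], the two even trace terms cancel; if just one is, both even means
    are [-1/2] and the other odd trace term is [0]. Neither is possible. *)
Lemma at_level2_0_parity22 (N a M e1 e2 o1 o2 : nat) (z : algC) :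
  (0 < N)%N -> N = (2 ^ a * M)%N -> odd M -> (0 < a)%N -> at_level 2 M 0 z ->
  ~~ odd e1 -> ~~ odd e2 -> odd o1 -> odd o2 ->
  eigsum [:: e1; e2; o1; o2] z <> - 4%:R.
Proof.
move=> N_gt0 eN oM a_gt0 zs ve1 ve2 vo1 vo2 ez; have zN := at_level_unity eN a_gt0 zs.
have evN : ~~ odd N by rewrite eN oddM oddX gtn_eqF.
have zdN d : z ^+ d ^+ N = 1 by rewrite exprAC zN expr1n.
have ne := at_level2_0_even zs; have no := at_level2_0_odd oM zs.
have := mean_sum N_gt0 zN ez; rewrite !big_cons big_nil.
move: ez; rewrite !eigsum_cons eigsum_nil addr0 => ez.
have tr0 o : odd o -> z ^+ o + z ^- o <> 0.
  move=> vo eo; apply: (odd_order_trace_neq0 oM (no o vo)).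
  by rewrite invrN -opprD eo oppr0.
have tr2 := odd_order_trace2_neq0 oM (ne e1 ve1) (ne e2 ve2).
have [[_ m3 x3]|m3] := twice_odd_order_cases N_gt0 evN (zdN o1) oM (no o1 vo1);
  have [[_ m4 x4]|m4] := twice_odd_order_cases N_gt0 evN (zdN o2) oM (no o2 vo2).
- move=> _; apply: tr2; apply: (addIr (-4%:R)); rewrite -[X in _ = _ + X]ez x3 x4; ring.
- have [[_ m1 x1]|[_ m1]|m1] := odd_order_cases N_gt0 (zdN e1) oM (ne e1 ve1);
  have [[_ m2 x2]|[_ m2]|m2] := odd_order_cases N_gt0 (zdN e2) oM (ne e2 ve2); try lra.
  move=> _; apply: (tr0 o2 vo2).
  apply: (addIr (-4%:R)); rewrite -[X in _ = _ + X]ez x3 x1 x2; ring.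
- have [[_ m1 x1]|[_ m1]|m1] := odd_order_cases N_gt0 (zdN e1) oM (ne e1 ve1);
  have [[_ m2 x2]|[_ m2]|m2] := odd_order_cases N_gt0 (zdN e2) oM (ne e2 ve2); try lra.
  move=> _; apply: (tr0 o1 vo1).
  apply: (addIr (-4%:R)); rewrite -[X in _ = _ + X]ez x4 x1 x2; ring.
have [[_ m1 x1]|[_ m1]|m1] := odd_order_cases N_gt0 (zdN e1) oM (ne e1 ve1);
have [[_ m2 x2]|[_ m2]|m2] := odd_order_cases N_gt0 (zdN e2) oM (ne e2 ve2); lra.
Qed.

Lemma order3_exp (R : comNzRingType) (y : R) : y ^+ 2 + y + 1 = 0 -> y ^+ 3 = 1.
Proof.
move=> e; apply/eqP; rewrite -subr_eq0 (_ : _ - 1 = (y - 1) * (y ^+ 2 + y + 1)).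
  by rewrite e mulr0.
by ring.
Qed.

Lemma order3_neq1 (y : algC) : y ^+ 2 + y + 1 = 0 -> y != 1.
Proof.
move=> e; apply/eqP => y1; move/eqP: e.
by rewrite y1 expr1n -(natrD _ 1 1) -(natrD _ 2 1) pnatr_eq0.
Qed.

Lemma dvdn3_prim_order (n d : nat) (z : algC) :
  n.-primitive_root z -> (z ^+ d) ^+ 2 + z ^+ d + 1 = 0 -> (3 %| n)%N.
Proof.
move=> prim_z e; apply: contraT => n3; case/negP: (order3_neq1 e).
rewrite -(prim_order_dvd prim_z) -(@Gauss_dvdl n d 3); last first.
  by rewrite coprime_sym prime_coprime.
by rewrite (prim_order_dvd prim_z) exprM (order3_exp e).
Qed.

Lemma dvdn3_exponent (n d m d0 : nat) (z : algC) :
  n.-primitive_root z -> (z ^+ d0) ^+ 2 + z ^+ d0 + 1 = 0 ->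
  coprime 3 m -> (z ^+ d) ^+ m = 1 -> (3 %| d)%N.
Proof.
move=> prim_z e c3m zd; have n3 := dvdn3_prim_order prim_z e.
rewrite -(Gauss_dvdl _ c3m); apply: dvdn_trans n3 _.
by rewrite (prim_order_dvd prim_z) exprM zd.
Qed.

(** Both exponents have [3]-adic valuation one less than that of [n]. *)
Lemma dvdn3_exponents (n b c : nat) (z : algC) :
  n.-primitive_root z -> (z ^+ b) ^+ 2 + z ^+ b + 1 = 0 ->
  (z ^+ c) ^+ 2 + z ^+ c + 1 = 0 -> (3 %| b)%N -> (3 %| c)%N.
Proof.
move=> prim_z eb ec /dvdnP[e eqb]; have n3 := dvdn3_prim_order prim_z eb.
have n3b : (n %| b * 3)%N by rewrite (prim_order_dvd prim_z) exprM order3_exp.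
have n3c : (n %| c * 3)%N by rewrite (prim_order_dvd prim_z) exprM order3_exp.
have nb : ~~ (n %| b)%N by rewrite (prim_order_dvd prim_z) order3_neq1.
case/dvdnP: n3 => n1 en.
have n1_3 : (3 %| n1)%N.
  apply: contraR nb => n13; rewrite en eqb dvdn_pmul2r //.
  rewrite -(@Gauss_dvdl n1 e 3); last by rewrite coprime_sym prime_coprime.
  by move: n3b; rewrite en eqb dvdn_pmul2r.
by move: n3c; rewrite en dvdn_pmul2r // => /(dvdn_trans n1_3).
Qed.

(** The means force [z ^+ o = -1], and the even powers to be one primitive cube root and two fifth
    roots of unity. As [3] divides the order of [z], it divides every exponent whose power has order
    prime to [3]. *)
Lemma at_level2_0_parity31 (N a M e1 e2 e3 o : nat) (z : algC) :
  (0 < N)%N -> N = (2 ^ a * M)%N -> odd M -> (0 < a)%N -> at_level 2 M 0 z ->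
  ~~ odd e1 -> ~~ odd e2 -> ~~ odd e3 -> odd o ->
  eigsum [:: e1; e2; e3; o] z = - 4%:R ->
  (3 %| o)%N /\ [\/ (3 %| e1)%N && (3 %| e2)%N, (3 %| e1)%N && (3 %| e3)%N
                  | (3 %| e2)%N && (3 %| e3)%N].
Proof.
move=> N_gt0 eN oM a_gt0 zs ve1 ve2 ve3 vo ez; have zN := at_level_unity eN a_gt0 zs.
have evN : ~~ odd N by rewrite eN oddM oddX gtn_eqF.
have zdN d : z ^+ d ^+ N = 1 by rewrite exprAC zN expr1n.
have ne := at_level2_0_even zs; have no := at_level2_0_odd oM zs.
have [n prim_z _] := prim_order_exists N_gt0 zN.
have := mean_sum N_gt0 zN ez; rewrite !big_cons big_nil.
move: ez; rewrite !eigsum_cons eigsum_nil addr0 => ez.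
have [[zo m4 x4]|m4] := twice_odd_order_cases N_gt0 evN (zdN o) oM (no o vo); last first.
  have h d : ~~ odd d -> - 2^-1 <= galois_mean N (z ^+ d).
    move=> vd.
    by have [[_ m _]|[_ m]|m] := odd_order_cases N_gt0 (zdN d) oM (ne d vd); lra.
  by move: (h e1 ve1) (h e2 ve2) (h e3 ve3) => h1 h2 h3 e; exfalso; move: e; lra.
have tr0 d : ~~ odd d -> z ^+ d + z ^- d = 0 -> False.
  by move=> vd; apply: (odd_order_trace_neq0 oM (ne d vd)).
have d3 d0 d : (z ^+ d0) ^+ 2 + z ^+ d0 + 1 = 0 -> z ^+ d ^+ 5 = 1 -> (3 %| d)%N.
  by move=> h0 hd; apply: dvdn3_exponent prim_z h0 _ hd.
have o3 d0 : (z ^+ d0) ^+ 2 + z ^+ d0 + 1 = 0 -> (3 %| o)%N.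
  by move=> h0; apply: (@dvdn3_exponent n o 2 d0 z) => //; rewrite zo sqrrN expr1n.
move: ez; rewrite x4.
have [[r1 m1 x1]|[f1 m1]|m1] := odd_order_cases N_gt0 (zdN e1) oM (ne e1 ve1);
have [[r2 m2 x2]|[f2 m2]|m2] := odd_order_cases N_gt0 (zdN e2) oM (ne e2 ve2);
have [[r3 m3 x3]|[f3 m3]|m3] := odd_order_cases N_gt0 (zdN e3) oM (ne e3 ve3);
  try by move=> _ e; exfalso; move: e; lra.
- rewrite x1 x2 => ez _; case: (tr0 e3 ve3).
  by apply: (addIr (-4%:R)); rewrite -[X in _ = _ + X]ez; ring.
- move=> _ _; split; first exact: o3 r1.
  by constructor 3; rewrite (d3 _ _ r1 f2) (d3 _ _ r1 f3).
- rewrite x1 x3 => ez _; case: (tr0 e2 ve2).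
  by apply: (addIr (-4%:R)); rewrite -[X in _ = _ + X]ez; ring.
- move=> _ _; split; first exact: o3 r2.
  by constructor 2; rewrite (d3 _ _ r2 f1) (d3 _ _ r2 f3).
- move=> _ _; split; first exact: o3 r3.
  by constructor 1; rewrite (d3 _ _ r3 f1) (d3 _ _ r3 f2).
rewrite x2 x3 => ez _; case: (tr0 e1 ve1).
by apply: (addIr (-4%:R)); rewrite -[X in _ = _ + X]ez; ring.
Qed.

(** The even means are [-1], [-1/2], [-1/2]. By [h3] one of the two exponents giving cube roots is
    divisible by [3], hence both are; the powers of orders [2] and [4] have exponents divisible by
    [3] as well. *)
Lemma at_level2_parity31 (N a M s e1 e2 e3 o : nat) (z : algC) :
  (0 < N)%N -> N = (2 ^ a * M)%N -> odd M -> (s < a)%N -> at_level 2 M s z ->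
  ~~ odd e1 -> ~~ odd e2 -> ~~ odd e3 -> odd o ->
  eigsum [:: e1; e2; e3] z = - 4%:R -> eigsum [:: o] z = 0 ->
  [\/ (3 %| e1)%N && (3 %| e2)%N, (3 %| e1)%N && (3 %| e3)%N
    | (3 %| e2)%N && (3 %| e3)%N] -> (3 %| o)%N /\ all (dvdn 3) [:: e1; e2; e3].
Proof.
move=> N_gt0 eN oM lt_sa zs ve1 ve2 ve3 vo ez ezo h3.
have zN := at_level_unity eN lt_sa zs.
have zdN d : z ^+ d ^+ N = 1 by rewrite exprAC zN expr1n.
have nzd d : z ^+ d != 0 := root_of_unity_neq0 N_gt0 (zdN d).
have [n prim_z _] := prim_order_exists N_gt0 zN.
move: ezo; rewrite eigsum_cons eigsum_nil addr0 => ezo.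
have s1 := at_level2_trace0 oM vo zs (nzd o) ezo.
have zo4 := trace0_exp4 (nzd o) ezo.
have tr0 d : ~~ odd d -> z ^+ d + z ^- d = 0 -> False.
  move=> vd /(trace0_sqr (nzd d)); rewrite -exprM => /(at_level2_logn oM zs).
  have [->|d_gt0] := posnP d; first by rewrite s1.
  have : (2 ^ 2 %| d * 2)%N by rewrite expnS expn1 dvdn_pmul2r // dvdn2.
  by rewrite pfactor_dvdn ?muln_gt0 ?d_gt0 // => + es; rewrite -es s1.
have arr x y w : z ^+ x = -1 -> (z ^+ y) ^+ 2 + z ^+ y + 1 = 0 ->
    (z ^+ w) ^+ 2 + z ^+ w + 1 = 0 -> (3 %| y)%N || (3 %| w)%N ->
    [/\ (3 %| o)%N, (3 %| x)%N, (3 %| y)%N & (3 %| w)%N].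
  move=> zx ry rw yw; have eyw : (3 %| y)%N = (3 %| w)%N.
    by apply/idP/idP; [apply: dvdn3_exponents prim_z ry rw
                      | apply: dvdn3_exponents prim_z rw ry].
  have dy : (3 %| y)%N by move: yw; rewrite eyw orbb.
  split=> //; last by rewrite -eyw.
    exact: dvdn3_exponent prim_z ry (isT : coprime 3 4) zo4.
  by apply: (@dvdn3_exponent n x 2 y z) => //; rewrite zx sqrrN expr1n.
have := mean_sum N_gt0 zN ez; rewrite !big_cons big_nil.
move: ez; rewrite !eigsum_cons eigsum_nil addr0.
have [[r1 m1 x1]|[r1 m1 x1]|m1] := root_cases N_gt0 (zdN e1);
have [[r2 m2 x2]|[r2 m2 x2]|m2] := root_cases N_gt0 (zdN e2);
have [[r3 m3 x3]|[r3 m3 x3]|m3] := root_cases N_gt0 (zdN e3);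
  try by move=> _ e; exfalso; move: e; lra.
- rewrite x1 x2 => ez _; case: (tr0 e3 ve3).
  by apply: (addIr (-4%:R)); rewrite -[X in _ = _ + X]ez; ring.
- move=> _ _; have [|h0 h1 h2 h4] := arr e1 e2 e3 r1 r2 r3.
    by case: h3 => /andP[h h']; rewrite ?h ?h' ?orbT.
  by rewrite /= h0 h1 h2 h4.
- rewrite x1 x3 => ez _; case: (tr0 e2 ve2).
  by apply: (addIr (-4%:R)); rewrite -[X in _ = _ + X]ez; ring.
- move=> _ _; have [|h0 h1 h2 h4] := arr e2 e1 e3 r2 r1 r3.
    by case: h3 => /andP[h h']; rewrite ?h ?h' ?orbT.
  by rewrite /= h0 h1 h2 h4.
- move=> _ _; have [|h0 h1 h2 h4] := arr e3 e1 e2 r3 r1 r2.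
    by case: h3 => /andP[h h']; rewrite ?h ?h' ?orbT.
  by rewrite /= h0 h1 h2 h4.
rewrite x2 x3 => ez _; case: (tr0 e1 ve1).
by apply: (addIr (-4%:R)); rewrite -[X in _ = _ + X]ez; ring.
Qed.

(** A finite search over the [N]-th roots of unity, which lets the conceded level depend on whether
    level [0] occurs. *)
Lemma at_level2_0_dec (l : seq nat) (N M : nat) (q : algC) :
  (0 < N)%N -> (M * 2 %| N)%N ->
  (exists2 z, at_level 2 M 0 z & eigsum l z = q) \/
  (forall z, at_level 2 M 0 z -> eigsum l z <> q).
Proof.
move=> N_gt0 MN; have [w prim_w] := C_prim_root_exists N_gt0.
pose test i := [&& (w ^+ i) ^+ (M * 2 ^ 1) == 1, (w ^+ i) ^+ (M * 2 ^ 0) != 1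
  & eigsum l (w ^+ i) == q].
have [/hasP[i _ /and3P[/eqP z1 z0 /eqP ez]]|/hasPn h] := boolP (has test (iota 0 N)).
  by left; exists (w ^+ i).
right=> z [z1 z0] ez; have zN := dvd_exp1 MN z1.
have [i ei] := prim_rootP prim_w zN.
have /h : (i : nat) \in iota 0 N by rewrite mem_iota ltn_ord.
by rewrite /test -ei z1 z0 ez !eqxx.
Qed.

(** As [4] divides [b + c = 12], one level may be conceded; its choice depends on the number of even
    distances. *)
Lemma no_perfect_4_7_5 :
  ~ exists l : 4.-tuple nat, has_perfect_2colouring (circulant l) 7 5.
Proof.
apply: (@no_perfect_levels 2 4 7 5 4) => // l N a M szl cl N_gt0 eN.
rewrite coprime2n => oM.
pose ev := [seq d <- l | ~~ odd d]; pose od := [seq d <- l | odd d].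
have pl : perm_eq l (ev ++ od) := perm_parity l.
have szeo : (size ev + size od = 4)%N by rewrite -size_cat -(perm_size pl).
have evP d : d \in ev -> ~~ odd d by rewrite mem_filter => /andP[].
have odP d : d \in od -> odd d by rewrite mem_filter => /andP[].
have szod : (0 < size od)%N := setwise_coprime_odd cl.
have split s z : (s.+1 < a)%N -> at_level 2 M s.+1 z -> eigsum l z = - 4%:R ->
    eigsum ev z = - 4%:R /\ eigsum od z = 0 := @eigsum_parity l N a M s 4 z eN oM.
have zdN z s d : (s < a)%N -> at_level 2 M s z -> z ^+ d ^+ N = 1.
  by move=> lt_sa zs; rewrite exprAC (at_level_unity eN lt_sa zs) expr1n.
have nz z s : (s < a)%N -> at_level 2 M s z -> z != 0.
  by move=> lt_sa zs; apply: (root_of_unity_neq0 N_gt0 (at_level_unity eN lt_sa zs)).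
have mean_ge z s d : (s < a)%N -> at_level 2 M s z -> -1 <= galois_mean N (z ^+ d).
  move=> lt_sa zs; have := galois_mean_bound N_gt0 (zdN z s d lt_sa zs).
  by have := ler_norm (- galois_mean N (z ^+ d)); rewrite normrN; lra.
case eev : ev szeo => [|e1 [|e2 [|e3 [|e4 ev']]]] /= szeo.
- exists [:: 0%N] => // -[//|s] z lt_sa _ zs /(split s z lt_sa zs)[+ _].
  by rewrite eev eigsum_nil => /esym/eqP; rewrite oppr_eq0 pnatr_eq0.
- exists [:: 0%N] => // -[//|s] z lt_sa _ zs /(split s z lt_sa zs)[+ _].
  move=> /(mean_sum N_gt0 (at_level_unity eN lt_sa zs)).
  rewrite eev big_seq1; have := mean_ge z s.+1 e1 lt_sa zs; lra.
(* Two even distances: at a positive level both even means are [-1], so [z ^+ e1 = -1] determines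
   the level. *)
- case eod : od szeo => [|o1 [|o2 [|? ?]]] // _.
  exists [:: logn 2 e1] => // -[|s] z lt_sa; rewrite inE => sE zs ez.
    have := @at_level2_0_parity22 N a M e1 e2 o1 o2 z N_gt0 eN oM lt_sa zs.
    apply; rewrite ?evP ?odP ?eev ?eod ?inE ?eqxx ?orbT //.
    by rewrite -ez (eigsum_perm _ pl) eev eod.
  have [eze _] := split s z lt_sa zs ez; rewrite eev in eze.
  have := mean_sum N_gt0 (at_level_unity eN lt_sa zs) eze.
  rewrite !big_cons big_nil.
  have [[z1 _ _]|[_ m1 _]|m1] := root_cases N_gt0 (zdN z s.+1 e1 lt_sa zs).
  - by move: sE; rewrite (at_level2_logn oM zs z1) eqxx.
  - by have := mean_ge z s.+1 e2 lt_sa zs; lra.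
  - by have := mean_ge z s.+1 e2 lt_sa zs; lra.
- case eod : od szeo => [|o [|? ?]] // _.
  have ve1 : ~~ odd e1 by rewrite evP // eev !inE eqxx.
  have ve2 : ~~ odd e2 by rewrite evP // eev !inE eqxx orbT.
  have ve3 : ~~ odd e3 by rewrite evP // eev !inE eqxx !orbT.
  have vo : odd o by rewrite odP // eod inE.
  have [a0|a_gt0] := posnP a; first by exists [:: 0%N] => // s z; rewrite a0.
  have MN : (M * 2 %| N)%N.
    by rewrite eN mulnC dvdn_mul // -{1}[2%N]expn1 dvdn_exp2l.
  (* The odd distance forces every positive level to be [1]. If level [0] occurs too, [3] divides
     all distances, against coprimality. *)
  have [[z0 z0s ez0]|h0] := at_level2_0_dec l (- 4%:R) N_gt0 MN; last first.
    exists [:: 1%N] => // -[|s] z lt_sa; rewrite inE => sE zs ez; first exact: h0 ez.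
    have [_ ezo] := split s z lt_sa zs ez; move: ezo.
    rewrite eod eigsum_cons eigsum_nil addr0.
    move=> /(at_level2_trace0 oM vo zs (expf_neq0 _ (nz z _ lt_sa zs))) es.
    by rewrite es in sE.
  exists [:: 0%N] => // -[//|s] z lt_sa _ zs ez.
  have [eze ezo] := split s z lt_sa zs ez; rewrite eev in eze; rewrite eod in ezo.
  rewrite (eigsum_perm _ pl) eev eod in ez0.
  have [_ h3] := at_level2_0_parity31 N_gt0 eN oM a_gt0 z0s ve1 ve2 ve3 vo ez0.
  have [d3o d3e] := at_level2_parity31 N_gt0 eN oM lt_sa zs ve1 ve2 ve3 vo eze ezo h3.
  suff : 3%N = 1%N by [].
  apply: cl; rewrite (perm_all _ pl) eev eod all_cat d3e /= d3o.
  by [].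
by move: szeo szod; lia.
Qed.

(* The listed parameters *)
Local Close Scope ring_scope.

Theorem corollary1 :
  (~ exists l : 2.-tuple nat, has_perfect_2colouring (circulant l) 4 3) /\
  (forall b c : nat,
     (b, c) \in [:: (5, 3); (5, 4); (6, 4); (6, 5)] ->
     ~ exists l : 3.-tuple nat, has_perfect_2colouring (circulant l) b c) /\
  (forall b c : nat,
     (b, c) \in [:: (6, 5); (7, 4); (8, 3); (7, 5);
                    (7, 6); (8, 5); (8, 6); (8, 7)] ->
     ~ exists l : 4.-tuple nat, has_perfect_2colouring (circulant l) b c).
Proof.
(* The sums [7], [11] and [13] are primes above [2 k + 1]; the five other pairs have composite
   sums. *)
split; first by apply: (no_perfect_prime (p := 7)).
split=> b c; rewrite !inE.
  case/or4P => /eqP[-> ->].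
  - exact: no_perfect_3_5_3.
  - exact: no_perfect_3_5_4.
  - exact: no_perfect_3_6_4.
  - exact: (no_perfect_prime (p := 11)).
case/orP => [/eqP[-> ->]|]; first exact: (no_perfect_prime (p := 11)).
case/orP => [/eqP[-> ->]|]; first exact: (no_perfect_prime (p := 11)).
case/orP => [/eqP[-> ->]|]; first exact: (no_perfect_prime (p := 11)).
case/orP => [/eqP[-> ->]|]; first exact: no_perfect_4_7_5.
case/or4P => /eqP[-> ->].
- exact: (no_perfect_prime (p := 13)).
- exact: (no_perfect_prime (p := 13)).
- exact: no_perfect_4_8_6.
- exact: no_perfect_4_8_7.
Qed.
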